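(* Let $(W,S)$ be a Coxeter group with a weight function $L:W\to\mathbf Z$, $L(s)>0$ for all $s\in S$, such that $W,L$ is bounded. If properties P1, P2, P3 and $\tilde{\mathrm P}$ (listed in the context) are assumed to be true, then properties P4, P5, P6, P7, P8, P9, P10, P11, P12, P13, P14 (listed in the context) are automatically true.
   Context: $(W,S)$ is a Coxeter group, $S$ finite, with length function $l$. A weight function is $L:W\to\mathbf Z$ with $L(ww')=L(w)+L(w')$ whenever $l(ww')=l(w)+l(w')$; we assume $L(s)>0$ for $s\in S$. $\mathcal A=\mathbf Z[v,v^{-1}]$, $v$ an indeterminate. $\mathcal H$ is the $\mathcal A$-algebra with $1$ with generators $T_s$ ($s\in S$) and relations $(T_s-v^{L(s)})(T_s+v^{-L(s)})=0$ and $T_sT_{s'}T_s\cdots=T_{s'}T_sT_{s'}\cdots$ ($m_{s,s'}$ factors on each side, for $s\ne s'$ with $m_{s,s'}=\mathrm{ord}(ss')<\infty$); it has $\mathcal A$-basis $T_w=T_{s_1}\cdots T_{s_q}$ ($w=s_1\cdots s_q$ a reduced expression). The bar involution is the ring involution of $\mathcal H$ with $\bar v=v^{-1}$, $\overline{T_s}=T_s^{-1}$. For $w\in W$, $c_w=\sum_y p_{y,w}T_y$ is the unique bar-invariant element of $\mathcal H$ with $p_{w,w}=1$ and $p_{y,w}\in v^{-1}\mathbf Z[v^{-1}]$ for $y\ne w$; the $c_w$ form an $\mathcal A$-basis of $\mathcal H$. Write $T_xT_y=\sum_z f_{x,y,z}T_z$, $c_xc_y=\sum_z h_{x,y,z}c_z$.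 $W,L$ is bounded if there is $N\in\mathbf N$ with $v^{-N}f_{x,y,z}\in\mathbf Z[v^{-1}]$ for all $x,y,z\in W$. Then for $z\in W$, $\mathbf a(z)$ is the smallest integer $\ge 0$ with $h_{x,y,z}\in v^{\mathbf a(z)}\mathbf Z[v^{-1}]$ for all $x,y\in W$, and $\gamma_{x,y,z^{-1}}\in\mathbf Z$ is the coefficient of $v^{\mathbf a(z)}$ in $h_{x,y,z}$. Define an integer $\Delta(z)\ge 0$ and $n_z\in\mathbf Z\setminus\{0\}$ by $p_{1,z}=n_zv^{-\Delta(z)}+$ strictly smaller powers of $v$, and let $\mathcal D=\{z\in W:\mathbf a(z)=\Delta(z)\}$. For $I\subset S$, $W_I$ is the subgroup of $W$ generated by $I$; it is a Coxeter group with set of simple reflections $I$, and is considered with the weight function $L|_{W_I}$. Preorders: $w\leftarrow_{\mathcal L}w'$ (resp. $w\leftarrow_{\mathcal R}w'$) if $c_w$ has nonzero coefficient in $c_sc_{w'}$ (resp. $c_{w'}c_s$) for some $s\in S$; $\le_{\mathcal L}$, $\le_{\mathcal R}$ are the preorders (reflexive transitive closures) generated by these, and $\le_{\mathcal{LR}}$ is the preorder generated by both. $\sim_{\mathcal L},\sim_{\mathcal R},\sim_{\mathcal{LR}}$ are the associated equivalence relations; their classes are the left, right, two-sided cells. P1. $\mathbf a(z)\le\Delta(z)$ for all $z\in W$. P2. If $d\in\mathcal D$ and $x,y\in W$ satisfy $\gamma_{x,y,d}\neq0$, then $x=y^{-1}$. P3. For any $y\in W$ there is a unique $d\in\mathcal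 D$ with $\gamma_{y^{-1},y,d}\ne0$. P4. If $z'\le_{\mathcal{LR}}z$ then $\mathbf a(z')\ge\mathbf a(z)$; hence, if $z'\sim_{\mathcal{LR}}z$, then $\mathbf a(z')=\mathbf a(z)$. P5. If $d\in\mathcal D$, $y\in W$, $\gamma_{y^{-1},y,d}\ne0$, then $\gamma_{y^{-1},y,d}=n_d=\pm1$. P6. If $d\in\mathcal D$, then $d^2=1$. P7. For any $x,y,z\in W$ we have $\gamma_{x,y,z}=\gamma_{y,z,x}$. P8. If $x,y,z\in W$ satisfy $\gamma_{x,y,z}\ne0$, then $x\sim_{\mathcal L}y^{-1}$, $y\sim_{\mathcal L}z^{-1}$, $z\sim_{\mathcal L}x^{-1}$. P9. If $z'\le_{\mathcal L}z$ and $\mathbf a(z')=\mathbf a(z)$, then $z'\sim_{\mathcal L}z$. P10. If $z'\le_{\mathcal R}z$ and $\mathbf a(z')=\mathbf a(z)$, then $z'\sim_{\mathcal R}z$. P11. If $z'\le_{\mathcal{LR}}z$ and $\mathbf a(z')=\mathbf a(z)$, then $z'\sim_{\mathcal{LR}}z$. P12. Let $I\subset S$. If $y\in W_I$, then $\mathbf a(y)$ computed in terms of $W_I$ equals $\mathbf a(y)$ computed in terms of $W$. P13. Any left cell $\Gamma$ of $W$ contains a unique element $d\in\mathcal D$, and $\gamma_{x^{-1},x,d}\ne0$ for all $x\in\Gamma$. P14. For any $z\in W$ we have $z\sim_{\mathcal{LR}}z^{-1}$. $\tilde{\mathrm P}$. If $x,y,z,z'\in W$ satisfy $\gamma_{x,y,z^{-1}}\ne0$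 and $z'\leftarrow_{\mathcal L}z$, then there exists $x'\in W$ such that the coefficient of $v^{\mathbf a(z)}$ in $h_{x',y,z'}$ is nonzero; in particular $\mathbf a(z')\ge\mathbf a(z)$. *)

(* Defs.v *)
From HB Require Import structures.
From mathcomp Require Import all_boot all_order all_algebra finmap.
From mathcomp Require Import monalg.
From mathcomp Require Import boolp classical_sets functions cardinality.
From Stdlib Require Import Relations.

Set Implicit Arguments.
Unset Strict Implicit.
Unset Printing Implicit Defensive.

Import Order.TTheory GRing.Theory Num.Theory.
Local Open Scope classical_set_scope.
Local Open Scope ring_scope.

(* ------------------------------------------------------------------------ *)
(* Laurent polynomials Z[v, v^-1]: the group ring of the additive group Z.  *)
(* The ring structure that monalg puts on {malg R[K]} requires K to be a    *)
(* monoid without units, so the convolution product is defined here.        *)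

Definition laurent : Type := {malg int[int]}.

HB.instance Definition _ := GRing.Zmodule.on laurent.

Definition lcoef (k : int) (p : laurent) : int := mcoeff k p.

(* vpow k is v^k. *)
Definition vpow (k : int) : laurent := << 1 *g k >>.

Section LaurentRing.
Implicit Types p q r : laurent.

Definition lmul p q : laurent :=
  \sum_(i <- msupp p) \sum_(j <- msupp q) << mcoeff i p * mcoeff j q *g i + j >>.

Lemma lmulw (d1 d2 : {fset int}) p q :
  (msupp p `<=` d1)%fset -> (msupp q `<=` d2)%fset ->
  lmul p q = \sum_(i <- d1) \sum_(j <- d2) << mcoeff i p * mcoeff j q *g i + j >>.
Proof.
move=> le1 le2; rewrite /lmul (big_fset_incl _ le1) /=.
  apply: eq_bigr => i _; apply/big_fset_incl => // k _ /mcoeff_outdom ->.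
  by rewrite mulr0 monalgU0.
move=> k _ /mcoeff_outdom pk.
by rewrite big1 => // j _; rewrite pk mul0r monalgU0.
Qed.

Lemma lmulC : commutative lmul.
Proof.
move=> p q; rewrite /lmul exchange_big /=.
by apply: eq_bigr => i _; apply: eq_bigr => j _; rewrite mulrC addrC.
Qed.

Lemma lmulDl : left_distributive lmul +%R.
Proof.
move=> p q r.
rewrite (@lmulw (msupp p `|` msupp q)%fset (msupp r) (p + q) r) //;
  last exact: msuppD_le.
rewrite (@lmulw (msupp p `|` msupp q)%fset (msupp r) p r) // ?fsubsetUl //.
rewrite (@lmulw (msupp p `|` msupp q)%fset (msupp r) q r) // ?fsubsetUr //.
rewrite -big_split /=; apply: eq_bigr => i _.
rewrite -big_split /=; apply: eq_bigr => j _.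
by rewrite mcoeffD mulrDl monalgUD.
Qed.

Lemma lmulDr : right_distributive lmul +%R.
Proof. by move=> p q r; rewrite lmulC lmulDl !(lmulC p). Qed.

Lemma lmul0 : left_zero 0 lmul.
Proof. by move=> p; rewrite /lmul msupp0 big_seq_fset0. Qed.

Lemma lmulr0 : right_zero 0 lmul.
Proof. by move=> p; rewrite lmulC lmul0. Qed.

Lemma lmulUU a b i j : lmul << a *g i >> << b *g j >> = << a * b *g i + j >>.
Proof. by rewrite (lmulw msuppU_le msuppU_le) !big_seq_fset1 !mcoeffUU. Qed.

Lemma lmul1 : left_id (vpow 0) lmul.
Proof.
move=> p; rewrite (lmulw msuppU_le (fsubset_refl _)) big_seq_fset1.
rewrite [RHS]monalgE; apply: eq_bigr => j _.
by rewrite mcoeffUU mul1r add0r.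
Qed.

Lemma lmul_suml I (s : seq I) (F : I -> laurent) q :
  lmul (\sum_(i <- s) F i) q = \sum_(i <- s) lmul (F i) q.
Proof. exact: (big_morph (lmul^~ q) (fun _ _ => lmulDl _ _ _) (lmul0 _)). Qed.

Lemma lmul_sumr I (s : seq I) (F : I -> laurent) q :
  lmul q (\sum_(i <- s) F i) = \sum_(i <- s) lmul q (F i).
Proof. exact: (big_morph (lmul q) (fun _ _ => lmulDr _ _ _) (lmulr0 _)). Qed.

Lemma lmulA : associative lmul.
Proof.
move=> p q r.
have El p' q' : lmul p' q' = \sum_(i <- msupp p') lmul << mcoeff i p' *g i >> q'.
  by rewrite {1}[p']monalgE lmul_suml.
have Er p' q' : lmul p' q' = \sum_(i <- msupp q') lmul p' << mcoeff i q' *g i >>.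
  by rewrite {1}[q']monalgE lmul_sumr.
rewrite [LHS]El [in RHS](El p q) [RHS]lmul_suml; apply: eq_bigr => i _.
rewrite (El q r) (Er _ q) [LHS]lmul_sumr [RHS]lmul_suml.
apply: eq_bigr => j _.
rewrite (Er _ r) [LHS]lmul_sumr [RHS]Er; apply: eq_bigr => k _.
by rewrite !lmulUU mulrA addrA.
Qed.

Lemma vpow0_neq0 : vpow 0 != 0.
Proof. by rewrite monalgU_eq0 oner_eq0. Qed.

End LaurentRing.

HB.instance Definition _ := GRing.Zmodule_isComNzRing.Build laurent
  lmulA lmulC lmul1 lmulDl vpow0_neq0.

(* p belongs to v^n Z[v^-1] *)
Definition in_vZ (n : int) (p : laurent) : Prop :=
  forall k : int, n < k -> lcoef k p = 0.

(* ------------------------------------------------------------------------ *)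

(* The least natural number satisfying P (0 if there is none). *)
Definition least (P : nat -> Prop) : nat :=
  xget 0%N [set n | P n /\ forall m, P m -> (n <= m)%N].

Definition has_order (G : groupType) (x : G) (m : nat) : Prop :=
  [/\ (0 < m)%N, (x ^+ m = 1)%g &
      forall k, (0 < k < m)%N -> (x ^+ k)%g <> 1%g].

Definition subgroup_set (G : groupType) (A : set G) : Prop :=
  [/\ A 1%g, forall x y, A x -> A y -> A (x * y)%g & forall x, A x -> A x^-1%g].

Definition gen (G : groupType) (A : set G) : set G :=
  smallest (@subgroup_set G) A.

(* The group W_I, as a group in its own right. *)
Section Parabolic.
Variables (W : groupType) (I : set W).

Definition in_gen : {pred W} := [pred w | w \in gen I].

Record parabolic := Parabolic { pval : W; _ : in_gen pval }.

HB.instance Definition _ := [isSub for pval].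
HB.instance Definition _ := [Choice of parabolic by <:].

Lemma in_gen_group_closed : group_closed in_gen.
Proof.
have mP w : reflect (gen I w) (w \in in_gen) by apply: (iffP idP); rewrite !inE.
split=> [|x y /mP hx /mP hy]; apply/mP => A [gA IA]; first by case: gA.
have Ax := hx A (conj gA IA); have Ay := hy A (conj gA IA).
by case: gA => _ AM AV; apply: AM => //; apply: AV.
Qed.

HB.instance Definition _ :=
  SubChoice_isSubGroup.Build W in_gen parabolic in_gen_group_closed.

Definition pgens : set parabolic := [set w | I (pval w)].

End Parabolic.

Arguments pgens {W} I _.

(* ------------------------------------------------------------------------ *)

Section Coxeter.
Variables (W : groupType) (S : set W).

(* W is presented by the generators s in S, all of order 2, and the         *)
(* relations (s s')^m = 1, m the order of s s' whenever it is finite        *)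
(* (m = 1 for s' = s gives s^2 = 1).                                        *)
Definition coxeter_system : Prop :=
  [/\ forall s, S s -> has_order s 2,
      gen S = [set: W] &
      forall (G : groupType) (f : W -> G),
        (forall s s' m, S s -> S s' -> has_order (s * s')%g m ->
           ((f s * f s') ^+ m = 1)%g) ->
        exists phi : {multiplicative W -> G}, forall s, S s -> phi s = f s].

Definition word (u : seq W) : Prop := forall s, s \in u -> S s.

Definition wprod (u : seq W) : W := (\prod_(s <- u) s)%g.

Definition len (w : W) : nat :=
  least (fun n => exists u : seq W, [/\ word u, size u = n & wprod u = w]).

Definition reduced (u : seq W) : Prop := word u /\ size u = len (wprod u).

Definition weight_function (L : W -> int) : Prop :=
  forall w w', len (w * w')%g = (len w + len w')%N ->
    L (w * w')%g = L w + L w'.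

End Coxeter.

(* ------------------------------------------------------------------------ *)

(* x y x ... (m factors) *)
Definition braid (A : nzRingType) (m : nat) (x y : A) : A :=
  \prod_(i < m) (if odd i then y else x).

Section Basis.
Variables (W : groupType) (H : lmodType laurent) (b : W -> H).

(* Finitely supported families of coefficients are elements of              *)
(* {malg laurent[W]}.                                                       *)
Definition lincomb (a : {malg laurent[W]}) : H :=
  \sum_(w <- msupp a) mcoeff w a *: b w.

Definition is_basis : Prop := forall x : H, exists! a, x = lincomb a.

(* The coefficient of b w in x (meaningful when b is a basis). *)
Definition coord (x : H) (w : W) : laurent :=
  mcoeff w (xget 0 [set a | x = lincomb a]).

End Basis.

Section Hecke.
Variables (W : groupType) (S : set W) (L : W -> int).

Definition hecke_relations (B : algType laurent) (t : W -> B) : Prop :=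
  (forall s, S s -> (t s - (vpow (L s))%:A) * (t s + (vpow (- L s))%:A) = 0) /\
  (forall s s' m, S s -> S s' -> s <> s' -> has_order (s * s')%g m ->
     braid m (t s) (t s') = braid m (t s') (t s)).

(* H is the algebra with generators t s (s in S) and the above relations;   *)
(* only the restriction of t to S matters.                                  *)
Definition hecke_presentation (H : algType laurent) (t : W -> H) : Prop :=
  hecke_relations t /\
  forall (B : algType laurent) (u : W -> B), hecke_relations u ->
    exists phi : {lrmorphism H -> B},
      (forall s, S s -> phi (t s) = u s) /\
      (forall psi : {lrmorphism H -> B},
         (forall s, S s -> psi (t s) = u s) -> psi =1 phi).

(* x has the properties that characterize c_w, bar being the bar involution *)
(* and T the standard basis.                                                *)
Definition is_canonical (H : algType laurent) (T : W -> H) (bar : H -> H)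
    (w : W) (x : H) : Prop :=
  [/\ bar x = x, coord T x w = 1 &
      forall y, y <> w -> in_vZ (-1) (coord T x y)].

(* The Hecke algebra of (W, S, L), with its standard basis T_w = stdb w,    *)
(* the bar involution and the basis c_w = canb w. All the components are    *)
(* determined up to a unique isomorphism.                                   *)
Record hecke_datum := HeckeDatum {
  hecke : algType laurent;
  stdb : W -> hecke;
  stdb_presentation : hecke_presentation stdb;
  stdb_reduced : forall u, reduced S u ->
    stdb (wprod u) = \prod_(s <- u) stdb s;
  stdb_basis : is_basis stdb;
  bar : {rmorphism hecke -> hecke};
  bar_involutive : involutive bar;
  bar_v : bar (vpow 1)%:A = (vpow (-1))%:A;
  bar_stdb : forall s, S s ->
    bar (stdb s) * stdb s = 1 /\ stdb s * bar (stdb s) = 1;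
  canb : W -> hecke;
  canb_canonical : forall w, unique (is_canonical stdb bar w) (canb w);
  canb_basis : is_basis canb
}.

Section Cells.
Variable D : hecke_datum.
Implicit Types w x y z : W.

Definition pcoef y w : laurent := coord (stdb D) (canb D w) y.

Definition fcoef x y z : laurent :=
  coord (stdb D) (stdb D x * stdb D y) z.

Definition hcoef x y z : laurent :=
  coord (canb D) (canb D x * canb D y) z.

Definition bounded : Prop :=
  exists N : nat, forall x y z, in_vZ 0 (vpow (- N%:Z) * fcoef x y z).

Definition afun z : nat :=
  least (fun n => forall x y, in_vZ n%:Z (hcoef x y z)).

(* gamma x y z^-1 is the coefficient of v^(a z) in h_{x,y,z}. *)
Definition gamma x y z : int := lcoef (afun z^-1%g)%:Z (hcoef x y z^-1%g).

(* p_{1,z} = n_z v^(- Delta z) + strictly smaller powers of v, n_z <> 0;    *)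
(* such an expression exists because p_{1,z} <> 0 for a positive weight     *)
(* function (the default value 0 of xget is never used).                    *)
Definition Delta z : nat :=
  xget 0%N [set n : nat | lcoef (- n%:Z) (pcoef 1%g z) <> 0 /\
                          in_vZ (- n%:Z) (pcoef 1%g z)].

Definition ncoef z : int := lcoef (- (Delta z)%:Z) (pcoef 1%g z).

Definition Dset : set W := [set z | afun z = Delta z].

(* arrowL w w' is w <-_L w', and preL w w' is w <=_L w'; likewise for R. *)
Definition arrowL w w' : Prop :=
  exists2 s, S s & coord (canb D) (canb D s * canb D w') w <> 0.

Definition arrowR w w' : Prop :=
  exists2 s, S s & coord (canb D) (canb D w' * canb D s) w <> 0.

Definition preL : W -> W -> Prop := clos_refl_trans W arrowL.
Definition preR : W -> W -> Prop := clos_refl_trans W arrowR.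
Definition preLR : W -> W -> Prop :=
  clos_refl_trans W (fun w w' => arrowL w w' \/ arrowR w w').

Definition simL w w' : Prop := preL w w' /\ preL w' w.
Definition simR w w' : Prop := preR w w' /\ preR w' w.
Definition simLR w w' : Prop := preLR w w' /\ preLR w' w.

Definition left_cell (C : set W) : Prop := exists w, C = [set x | simL x w].

Definition P1 : Prop := forall z, (afun z <= Delta z)%N.

Definition P2 : Prop :=
  forall d x y, Dset d -> gamma x y d <> 0 -> x = y^-1%g.

Definition P3 : Prop :=
  forall y, exists! d, Dset d /\ gamma y^-1%g y d <> 0.

Definition P4 : Prop :=
  (forall z' z, preLR z' z -> (afun z <= afun z')%N) /\
  (forall z' z, simLR z' z -> afun z' = afun z).

Definition P5 : Prop :=
  forall d y, Dset d -> gamma y^-1%g y d <> 0 ->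
    gamma y^-1%g y d = ncoef d /\ (ncoef d = 1 \/ ncoef d = -1).

Definition P6 : Prop := forall d, Dset d -> (d ^+ 2 = 1)%g.

Definition P7 : Prop := forall x y z, gamma x y z = gamma y z x.

Definition P8 : Prop :=
  forall x y z, gamma x y z <> 0 ->
    [/\ simL x y^-1%g, simL y z^-1%g & simL z x^-1%g].

Definition P9 : Prop :=
  forall z' z, preL z' z -> afun z' = afun z -> simL z' z.

Definition P10 : Prop :=
  forall z' z, preR z' z -> afun z' = afun z -> simR z' z.

Definition P11 : Prop :=
  forall z' z, preLR z' z -> afun z' = afun z -> simLR z' z.

Definition P13 : Prop :=
  forall C : set W, left_cell C ->
    exists d, [/\ C d /\ Dset d,
      forall d', C d' -> Dset d' -> d' = d &
      forall x, C x -> gamma x^-1%g x d <> 0].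

Definition P14 : Prop := forall z, simLR z z^-1%g.

Definition Ptilde : Prop :=
  forall x y z z', gamma x y z^-1%g <> 0 -> arrowL z' z ->
    (exists x', lcoef (afun z)%:Z (hcoef x' y z') <> 0) /\
    (afun z <= afun z')%N.

End Cells.
End Hecke.

(* The Hecke algebra datum DI of W_I with weight function L|W_I is unique   *)
(* up to isomorphism, so quantifying over it universally loses nothing.     *)
Definition P12 (W : groupType) (S : set W) (L : W -> int)
    (D : hecke_datum S L) : Prop :=
  forall I : set W, I `<=` S ->
  forall DI : hecke_datum (pgens I) (fun w : parabolic I => L (pval w)),
  forall y : parabolic I, afun DI y = afun D (pval y).

(* Main.v *)
(** Lusztig's argument.  Every [z] has [x], [y] with [gamma x y z <> 0], so P~
    makes [a] monotone for <=_L, and, through the anti-involution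
    T_w |-> T_(w^-1), for <=_R: this is P4.  P5 compares constant terms in
    tau(c_(y^-1) c_y) = \sum_z h_(y^-1,y,z) p_(1,z), where P1 and P3 leave a
    single term.  P7 compares the coefficients of v^(2 a(d)) in the two
    expansions of c_x c_y c_z at c_(d^-1), where P2 leaves a single term on each
    side.  P8 is then immediate, and P9 - P11, P13, P14 follow by pushing a
    nonzero [gamma] along the arrows of the preorder with P~, P7 and P8.  For P12,
    the Hecke algebra of W_I embeds so that c_y goes to c_y, and P7 turns
    [gamma y^-1 y d <> 0] into a nonzero coefficient of v^(a(y)) in h_(y,d,y) with
    [y], [d] in W_I. *)

Require Import Defs.
From HB Require Import structures.
From mathcomp Require Import all_boot all_order all_algebra all_fingroup finmap.
From mathcomp Require Import monalg zify.
From mathcomp Require Import boolp classical_sets functions cardinality.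
From Stdlib Require Import Relations.
(* [coord] is also the name of a constant of mathcomp's vector.v. *)
Import Defs.

Set Implicit Arguments.
Unset Strict Implicit.
Unset Printing Implicit Defensive.

Import Order.TTheory GRing.Theory Num.Theory.
Local Open Scope classical_set_scope.
Local Open Scope ring_scope.

(** [i0] may lie outside [s]: the sums collapsed this way run over supports, and off the support the
    term vanishes anyway. *)
Lemma sum_at (V : nmodType) (I : eqType) (s : seq I) (F : I -> V) i0 :
  uniq s -> (forall i, i \in s -> i != i0 -> F i = 0) ->
  (i0 \notin s -> F i0 = 0) -> \sum_(i <- s) F i = F i0.
Proof.
move=> us F0 Fs; have [i0s|i0s] := boolP (i0 \in s).
  rewrite (big_rem i0) //= big_seq big1 ?addr0 // => i.
  by rewrite mem_rem_uniq // => /andP[ii0 si]; apply: F0.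
rewrite Fs // big_seq big1 // => i si; apply: F0 => //.
by apply: contraNneq i0s => <-.
Qed.

(** * Degrees and leading coefficients in Z[v, v^-1] *)

Section LaurentDegree.
Implicit Types (p q : laurent) (m n k : int).

Lemma lcoef0 k : lcoef k 0 = 0.
Proof. exact: mcoeff0. Qed.

Lemma lcoefD k p q : lcoef k (p + q) = lcoef k p + lcoef k q.
Proof. exact: mcoeffD. Qed.

Lemma lcoef_sum k I (s : seq I) (P : pred I) (F : I -> laurent) :
  lcoef k (\sum_(i <- s | P i) F i) = \sum_(i <- s | P i) lcoef k (F i).
Proof. exact: (big_morph (lcoef k) (lcoefD k) (lcoef0 k)). Qed.

Lemma lcoef_vpow k m : lcoef k (vpow m) = (m == k)%:R.
Proof. by rewrite /lcoef mcoeffU. Qed.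

Lemma lcoef1 k : lcoef k 1 = (0 == k)%:R.
Proof. exact: lcoef_vpow. Qed.

Lemma laurent_eq0P p : p = 0 <-> forall k, lcoef k p = 0.
Proof.
split=> [-> k|p0]; first exact: lcoef0.
by apply/malgP => k; rewrite mcoeff0; apply: p0.
Qed.

Lemma vpowD m n : vpow (m + n) = vpow m * vpow n.
Proof. by rewrite -[RHS]/(lmul _ _) lmulUU mulr1. Qed.

Lemma vpow_neq m n : m <> n -> vpow m - vpow n <> 0.
Proof.
move=> mn /laurent_eq0P /(_ m) /eqP; rewrite /lcoef mcoeffB !mcoeffU eqxx.
by rewrite (introF eqP (not_eq_sym mn)) subr0.
Qed.

Lemma lmulE p q :
  p * q = \sum_(i <- msupp p) \sum_(j <- msupp q)
    << mcoeff i p * mcoeff j q *g i + j >>.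
Proof. by []. Qed.

Lemma in_vZ0 n : in_vZ n 0.
Proof. by move=> k _; rewrite lcoef0. Qed.

Lemma in_vZD n p q : in_vZ n p -> in_vZ n q -> in_vZ n (p + q).
Proof. by move=> hp hq k nk; rewrite lcoefD hp // hq // addr0. Qed.

Lemma in_vZ_sum n (I : eqType) (s : seq I) (F : I -> laurent) :
  (forall i, i \in s -> in_vZ n (F i)) -> in_vZ n (\sum_(i <- s) F i).
Proof.
move=> hF; rewrite big_seq; apply: (big_ind (in_vZ n)) => //.
- exact: in_vZ0.
- exact: in_vZD.
Qed.

Lemma in_vZ_le m n p : m <= n -> in_vZ m p -> in_vZ n p.
Proof. by move=> mn hp k nk; apply: hp; apply: le_lt_trans mn nk. Qed.

Lemma in_vZ_vpow n : in_vZ n (vpow n).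
Proof. by move=> k nk; rewrite lcoef_vpow lt_eqF. Qed.

Lemma in_vZ1 : in_vZ 0 1.
Proof. exact: in_vZ_vpow. Qed.

Lemma in_vZ_lead n p : in_vZ (n + 1) p -> lcoef (n + 1) p = 0 -> in_vZ n p.
Proof.
move=> hp p0 k nk; have [<-//|] := eqVneq (n + 1) k.
by move=> nk1; apply: hp; rewrite lt_neqAle nk1 lezD1.
Qed.

(** Among exponents i <= m and j <= n, only i = m and j = n add up to m + n. *)
Lemma in_vZM_lcoef m n p q : in_vZ m p -> in_vZ n q ->
  in_vZ (m + n) (p * q) /\ lcoef (m + n) (p * q) = lcoef m p * lcoef n q.
Proof.
move=> hp hq.
have bd (r : laurent) b i : in_vZ b r -> i \in msupp r -> i <= b.
  move=> hr; rewrite -mcoeff_neq0 leNgt; apply: contra_neqN => bi; exact: hr.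
split.
  move=> k mnk; rewrite lmulE lcoef_sum big_seq big1 // => i ip.
  rewrite lcoef_sum big_seq big1 // => j jq.
  rewrite /lcoef mcoeffU; case: eqP => // ijk.
  have := lerD (bd _ _ _ hp ip) (bd _ _ _ hq jq).
  by rewrite ijk leNgt mnk.
rewrite lmulE lcoef_sum (@sum_at _ _ _ _ m) ?fset_uniq //.
- rewrite lcoef_sum (@sum_at _ _ _ _ n) ?fset_uniq //.
  + by rewrite /lcoef mcoeffUU.
  + move=> j _ jn; rewrite /lcoef mcoeffU; case: eqP => // /addrI /eqP.
    by rewrite (negbTE jn).
  + by move=> /mcoeff_outdom ->; rewrite mulr0 monalgU0 lcoef0.
- move=> i ip im; rewrite lcoef_sum big_seq big1 // => j jq.
  rewrite /lcoef mcoeffU; case: eqP => // ijk.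
  have im' : i < m by rewrite lt_neqAle im (bd _ _ _ hp ip).
  by have := ltr_leD im' (bd _ _ _ hq jq); rewrite ijk ltxx.
- move=> /mcoeff_outdom ->; rewrite lcoef_sum big1 // => j _.
  by rewrite mul0r monalgU0 lcoef0.
Qed.

Lemma in_vZM m n p q : in_vZ m p -> in_vZ n q -> in_vZ (m + n) (p * q).
Proof. by move=> hp hq; case: (in_vZM_lcoef hp hq). Qed.

Lemma lcoefM m n p q : in_vZ m p -> in_vZ n q ->
  lcoef (m + n) (p * q) = lcoef m p * lcoef n q.
Proof. by move=> hp hq; case: (in_vZM_lcoef hp hq). Qed.

Lemma in_vZ_bound p : exists N : nat, in_vZ N%:Z p.
Proof.
exists (\max_(i <- msupp p) absz i)%N => k lk.
apply/eqP; rewrite mcoeff_eq0; apply/negP => kp.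
have := @leq_bigmax_seq _ _ xpredT absz _ kp isT.
by move: lk; set M := (\max_(i <- _) _)%N; lia.
Qed.

(** Induction over the ring generators v and v^-1 suits the bar involution, which is a ring morphism
    but not linear over Z[v, v^-1]. *)
Lemma laurent_ind (P : laurent -> Prop) :
  (forall p q, P p -> P q -> P (p + q)) -> (forall p, P p -> P (- p)) ->
  (forall p q, P p -> P q -> P (p * q)) ->
  P 1 -> P (vpow 1) -> P (vpow (-1)) -> forall p, P p.
Proof.
move=> PD PN PM P1 Pv Pv' p.
have P0 : P 0 by rewrite -(subrr 1); apply: PD => //; apply: PN.
have Pn (n : nat) : P (vpow n%:Z) /\ P (vpow (- n%:Z)).
  elim: n => [|n [IH1 IH2]]; first by rewrite oppr0.
  by rewrite -addn1 PoszD opprD !vpowD; split; apply: PM.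
have Pk k : P (vpow k) by case: k => n; [case: (Pn n) | rewrite NegzE; case: (Pn n.+1)].
have PMn q (n : nat) : P q -> P (q *+ n).
  by move=> Pq; elim: n => [|n IH]; rewrite ?mulr0n ?mulrS //; apply: PD.
rewrite [p]monalgE; apply: (big_ind P) => // i _.
have -> (a : int) : << a *g i >> = vpow i *~ a.
  by apply/malgP => j; rewrite raddfMz /= !mcoeffU; case: eqP => _;
     rewrite ?mulr1n ?mulr0n ?mul0rz // intz.
case: (mcoeff i p) => n; first by rewrite -pmulrn; apply: PMn.
by rewrite NegzE mulrNz -pmulrn; apply/PN/PMn.
Qed.

End LaurentDegree.

(** * Coordinates in a basis indexed by W *)

Section CoordTheory.
Variables (W : groupType) (H : lmodType laurent) (b : W -> H).
Hypothesis b_basis : is_basis b.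
Implicit Types (x y : H) (w : W) (a : {malg laurent[W]}).

Lemma lincombEw (d : {fset W}) a : (msupp a `<=` d)%fset ->
  lincomb b a = \sum_(w <- d) mcoeff w a *: b w.
Proof.
move=> ad; rewrite /lincomb (big_fset_incl _ ad) // => w _ /mcoeff_outdom ->.
by rewrite scale0r.
Qed.

Lemma lincombD a1 a2 : lincomb b (a1 + a2) = lincomb b a1 + lincomb b a2.
Proof.
rewrite (@lincombEw (msupp a1 `|` msupp a2)%fset) ?msuppD_le //.
rewrite (@lincombEw (msupp a1 `|` msupp a2)%fset a1) ?fsubsetUl //.
rewrite (@lincombEw (msupp a1 `|` msupp a2)%fset a2) ?fsubsetUr //.
by rewrite -big_split; apply: eq_bigr => w _; rewrite mcoeffD scalerDl.
Qed.

Lemma lincombZ p a : lincomb b (p *: a) = p *: lincomb b a.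
Proof.
rewrite (@lincombEw (msupp a)) ?msuppZ_le // scaler_sumr.
by apply: eq_bigr => w _; rewrite mcoeffZ scalerA.
Qed.

Lemma lincombU p w : lincomb b << p *g w >> = p *: b w.
Proof. by rewrite (@lincombEw [fset w]%fset) ?msuppU_le // big_seq_fset1 mcoeffUU. Qed.

Definition coords x : {malg laurent[W]} := xget 0 [set a | x = lincomb b a].

Lemma coordE x w : coord b x w = mcoeff w (coords x).
Proof. by []. Qed.

Lemma coordsK x : lincomb b (coords x) = x.
Proof.
have [a [xa _]] := b_basis x.
by rewrite /coords; case: xgetP => [c _ /= <-//|/(_ a)].
Qed.

Lemma lincombK a : coords (lincomb b a) = a.
Proof.
have [c [_ cu]] := b_basis (lincomb b a).
by transitivity c; [symmetry|]; apply: cu; rewrite ?coordsK.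
Qed.

Lemma coord_expand x : x = \sum_(w <- msupp (coords x)) coord b x w *: b w.
Proof. by rewrite -{1}[x]coordsK. Qed.

Lemma coordD x y w : coord b (x + y) w = coord b x w + coord b y w.
Proof. by rewrite !coordE -{1}(coordsK x) -{1}(coordsK y) -lincombD lincombK mcoeffD. Qed.

Lemma coordZ p x w : coord b (p *: x) w = p * coord b x w.
Proof. by rewrite !coordE -{1}(coordsK x) -lincombZ lincombK mcoeffZ. Qed.

Lemma coord0 w : coord b 0 w = 0.
Proof. by rewrite -(scale0r 0) coordZ mul0r. Qed.

Lemma coord_sum I (s : seq I) (P : pred I) (F : I -> H) w :
  coord b (\sum_(i <- s | P i) F i) w = \sum_(i <- s | P i) coord b (F i) w.
Proof.
exact: (big_morph (fun x => coord b x w) (fun x y => coordD x y w) (coord0 w)).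
Qed.

Lemma coord_b w w' : coord b (b w) w' = (w == w')%:R.
Proof. by rewrite coordE -[b w]scale1r -lincombU lincombK mcoeffU. Qed.

Lemma coord_neq0 x w : (coord b x w != 0) = (w \in msupp (coords x)).
Proof. by rewrite mcoeff_neq0. Qed.

Lemma basis_ind (P : H -> Prop) :
  P 0 -> (forall x y, P x -> P y -> P (x + y)) ->
  (forall p x, P x -> P (p *: x)) -> (forall w, P (b w)) -> forall x, P x.
Proof.
move=> P0 PD PZ Pb x; rewrite [x]coord_expand.
by apply: (big_ind P) => // w _; apply: PZ.
Qed.

(** The linear extension of [b w |-> f w]. *)
Definition blin (H' : lmodType laurent) (f : W -> H') x : H' :=
  \sum_(w <- msupp (coords x)) coord b x w *: f w.

Lemma blinEw (H' : lmodType laurent) (f : W -> H') (d : {fset W}) x :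
  (msupp (coords x) `<=` d)%fset -> blin f x = \sum_(w <- d) coord b x w *: f w.
Proof.
move=> ad; rewrite /blin (big_fset_incl _ ad) // => w _ /mcoeff_outdom.
by rewrite -coordE => ->; rewrite scale0r.
Qed.

Lemma blinD (H' : lmodType laurent) (f : W -> H') x y :
  blin f (x + y) = blin f x + blin f y.
Proof.
pose d := (msupp (coords x) `|` msupp (coords y) `|` msupp (coords (x + y)))%fset.
rewrite !(@blinEw _ _ d) /d; first last.
- exact: fsubsetUr.
- by rewrite -fsetUA fsubsetUl.
- by rewrite fsetUAC fsubsetUr.
by rewrite -big_split; apply: eq_bigr => w _; rewrite coordD scalerDl.
Qed.

Lemma blinZ (H' : lmodType laurent) (f : W -> H') p x :
  blin f (p *: x) = p *: blin f x.
Proof.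
pose d := (msupp (coords x) `|` msupp (coords (p *: x)))%fset.
rewrite !(@blinEw _ _ d) /d ?fsubsetUl ?fsubsetUr // scaler_sumr.
by apply: eq_bigr => w _; rewrite coordZ scalerA.
Qed.

Lemma blin0 (H' : lmodType laurent) (f : W -> H') : blin f 0 = 0.
Proof. by rewrite -(scale0r 0) blinZ scale0r. Qed.

Lemma blin_b (H' : lmodType laurent) (f : W -> H') w : blin f (b w) = f w.
Proof.
rewrite (@blinEw _ _ [fset w]%fset).
  by rewrite big_seq_fset1 coord_b eqxx scale1r.
by rewrite -[b w]scale1r -lincombU lincombK msuppU_le.
Qed.

End CoordTheory.

(** * Reduced words and length *)

Section CoxeterLength.
Variables (W : groupType) (S : set W).
Implicit Types (w : W) (u : seq W).

Lemma least_spec (P : nat -> Prop) : (exists n, P n) ->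
  P (least P) /\ forall m, P m -> (least P <= m)%N.
Proof.
move=> [n Pn]; have exP : exists n, `[< P n >] by exists n; apply/asboolP.
case: (ex_minnP exP) => m /asboolP Pm m_min; rewrite /least.
case: xgetP => [k _ [Pk k_min]|/(_ m)[]]; first by split.
by split=> // k Pk; apply: m_min; apply/asboolP.
Qed.

Lemma wprod_nil : wprod [::] = 1%g :> W.
Proof. by rewrite /wprod big_nil. Qed.

Lemma wprod_cons s u : wprod (s :: u) = (s * wprod u)%g.
Proof. by rewrite /wprod big_cons. Qed.

Lemma wprod_cat u1 u2 : wprod (u1 ++ u2) = (wprod u1 * wprod u2)%g.
Proof. by rewrite /wprod big_cat. Qed.

Lemma word_cat u1 u2 : word S u1 -> word S u2 -> word S (u1 ++ u2).
Proof. by move=> w1 w2 s; rewrite mem_cat => /orP[/w1|/w2]. Qed.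

Lemma word1 s : S s -> word S [:: s].
Proof. by move=> Ss t; rewrite inE => /eqP ->. Qed.

Lemma word_consP s u : word S (s :: u) <-> S s /\ word S u.
Proof.
split=> [h|[Ss hu]]; first by split=> [|t tu]; apply: h; rewrite inE ?eqxx ?tu ?orbT.
by rewrite -cat1s; apply: word_cat => //; apply: word1.
Qed.

Hypothesis S_sq : forall s, S s -> (s * s = 1)%g.

Lemma gensV s : S s -> (s^-1)%g = s.
Proof. by move=> Ss; apply: (mulgI s); rewrite mulgV S_sq. Qed.

Lemma word_rev u : word S u -> word S (rev u) /\ wprod (rev u) = (wprod u)^-1%g.
Proof.
elim: u => [_|s u IH /word_consP[Ss /IH[h1 h2]]].
  by rewrite wprod_nil invg1; split.
rewrite rev_cons -cats1; split; first by apply: word_cat => //; apply: word1.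
by rewrite wprod_cat h2 !wprod_cons wprod_nil mulg1 invgM (gensV Ss).
Qed.

Lemma gen_word w : gen S w -> exists2 u, word S u & wprod u = w.
Proof.
move=> /(_ [set w | exists2 u, word S u & wprod u = w]); apply.
split; last first.
  by move=> s Ss; exists [:: s]; [apply: word1 | rewrite wprod_cons wprod_nil mulg1].
split.
- by exists [::]; rewrite ?wprod_nil.
- move=> _ _ [u1 h1 <-] [u2 h2 <-]; exists (u1 ++ u2); last exact: wprod_cat.
  exact: word_cat.
- by move=> _ [u h <-]; exists (rev u); case: (word_rev h).
Qed.

Hypothesis S_gen : forall w, gen S w.

Lemma reduced_word w : exists2 u, reduced S u & wprod u = w.
Proof.
have [u hu uw] := gen_word (S_gen w).
have [] := @least_spec (fun n => exists u : seq W, [/\ word S u, size u = n & wprod u = w]).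
  by exists (size u), u.
by move=> [u' [h1 h2 h3]] _; exists u' => //; split=> //; rewrite h3.
Qed.

Lemma len_le u : word S u -> (len S (wprod u) <= size u)%N.
Proof.
move=> hu; have [] := @least_spec
    (fun n => exists u' : seq W, [/\ word S u', size u' = n & wprod u' = wprod u]).
  by exists (size u), u.
by move=> _; apply; exists u.
Qed.

Lemma reduced_nil : reduced S [::].
Proof. by split=> //; apply/eqP; rewrite eq_sym -leqn0 (len_le (u := [::])). Qed.

Lemma len1 : len S 1 = 0%N.
Proof. by case: reduced_nil; rewrite wprod_nil. Qed.

Lemma len_gen s : S s -> (len S s <= 1)%N.
Proof.
by move=> Ss; have := len_le (word1 Ss); rewrite wprod_cons wprod_nil mulg1.
Qed.

Lemma lenM w1 w2 : (len S (w1 * w2) <= len S w1 + len S w2)%N.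
Proof.
have [u1 [h1 h2] <-] := reduced_word w1; have [u2 [h3 h4] <-] := reduced_word w2.
by rewrite -wprod_cat -h2 -h4 -size_cat; apply/len_le/word_cat.
Qed.

Lemma lenV w : len S w^-1 = len S w.
Proof.
suff le x : (len S x^-1 <= len S x)%N.
  by apply/eqP; rewrite eqn_leq le -{1}[w]invgK le.
have [u [h1 h2] <-] := reduced_word x; have [h3 <-] := word_rev h1.
by rewrite -h2 -(size_rev u); apply: len_le.
Qed.

Lemma reduced_behead s u : reduced S (s :: u) ->
  reduced S u /\ len S (s * wprod u) = (len S (wprod u)).+1.
Proof.
move=> [/word_consP[Ss hu]]; rewrite wprod_cons /= => hl.
have lu : size u = len S (wprod u).
  apply/eqP; rewrite eqn_leq len_le // andbT.
  by have := lenM s (wprod u); have := len_gen Ss; move: hl; lia.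
by split=> //; rewrite -hl lu.
Qed.

Lemma len_ind (P : W -> Prop) : P 1%g ->
  (forall s w, S s -> len S (s * w) = (len S w).+1 -> P w -> P (s * w)%g) ->
  forall w, P w.
Proof.
move=> P1 PS w; have [u ru <-] := reduced_word w.
elim: u ru => [|s u IH] ru; first by rewrite wprod_nil.
have /word_consP[Ss _] := ru.1; have [ru' hl] := reduced_behead ru.
by rewrite wprod_cons; apply: PS => //; apply: IH.
Qed.

End CoxeterLength.

(** * Parity of the length *)

Section CoxeterParity.
Variables (W : groupType) (S : set W).
Hypothesis WS : coxeter_system S.
Implicit Types (w : W) (u : seq W).

Lemma coxeter_sq s : S s -> (s * s = 1)%g.
Proof. by case: WS => h _ _ /h[_]. Qed.

Lemma coxeter_neq1 s : S s -> s != 1%g.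
Proof. by case: WS => h _ _ /h[_ _ /(_ 1%N isT)] ne; apply/eqP; rewrite -(expg1 s). Qed.

Lemma coxeter_gen w : gen S w.
Proof. by case: WS => _ -> _. Qed.

(** The sign character: sending every generator to the transposition of [bool] respects all
    relations, so the presentation of W provides a morphism that reads off the parity of the
    length. *)
Lemma odd_len_gen s w : S s -> odd (len S (s * w)) = ~~ odd (len S w).
Proof.
pose t : {perm bool} := tperm false true.
have tt : (t * t = 1)%g by rewrite tperm2.
case: (WS) => _ _ /(_ _ (fun=> t))[].
  by move=> *; rewrite tt expg1n.
move=> phi phiS.
have phi1 : phi 1%g = 1%g by apply: (mulgI (phi 1%g)); rewrite -gmulfM !mulg1.
have phi_len x : phi x = (if odd (len S x) then t else 1)%g.
  have [u [h1 h2] <-] := reduced_word coxeter_sq coxeter_gen x; rewrite -h2.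
  elim: u h1 {h2} => [|r u IH] /=; first by rewrite wprod_nil phi1.
  move=> /word_consP[Sr hu]; rewrite wprod_cons gmulfM phiS // IH //.
  by case: odd; rewrite /= ?tt ?mulg1.
have t1 : (t == 1%g) = false.
  by apply/eqP => /permP /(_ false); rewrite tpermL perm1.
move=> Ss; have := phi_len (s * w)%g; rewrite gmulfM phiS // phi_len.
case: (odd (len S w)); case: odd => //=; rewrite ?tt ?mulg1 => /eqP; rewrite ?t1 //.
by rewrite eq_sym t1.
Qed.

(** Subadditivity bounds the change of length by 1, and parity excludes equality. *)
Lemma len_gen_mul s w : S s ->
  len S (s * w) = (len S w).+1 \/ len S w = (len S (s * w)).+1.
Proof.
move=> Ss; have p := odd_len_gen w Ss.
have [sq ge] := (coxeter_sq, coxeter_gen).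
have := lenM sq ge s w; have := lenM sq ge s (s * w)%g.
rewrite mulgA sq // mul1g; have := len_gen Ss; move: p.
by move: (len S (s * w)) (len S w) (len S s); lia.
Qed.

End CoxeterParity.

(** Ring induction over the T_s, v and v^-1. It serves in particular to compare maps with [bar],
    which is only semilinear. *)
Lemma hecke_ind (W : groupType) (S : set W) (L : W -> int)
    (S_sq : forall s, S s -> (s * s = 1)%g) (S_gen : forall w, gen S w)
    (D : hecke_datum S L) (P : hecke D -> Prop) :
  (forall g h, P g -> P h -> P (g + h)) -> (forall h, P h -> P (- h)) ->
  (forall g h, P g -> P h -> P (g * h)) ->
  P 1 -> P (vpow 1)%:A -> P (vpow (-1))%:A ->
  (forall s, S s -> P (stdb D s)) -> forall h, P h.
Proof.
move=> PD PN PM P1 Pv Pv' PT; have P0 : P 0 by rewrite -(subrr 1); auto.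
have PA p : P p%:A.
  move: p; apply: laurent_ind => // [p q|p|p q|]; rewrite ?scale1r //.
  - by rewrite scalerDl; apply: PD.
  - by rewrite scaleNr; apply: PN.
  - by move=> hp hq; rewrite -scalerA -[q%:A]mul1r scalerAl; apply: PM.
apply: (basis_ind (@stdb_basis _ _ _ D)) => // [p x hx|w].
  by rewrite -[x]mul1r scalerAl; apply: PM.
have [u ru <-] := reduced_word S_sq S_gen w; rewrite stdb_reduced //.
rewrite big_seq; apply: (big_ind P) => // s /ru.1; exact: PT.
Qed.

(** * Multiplication by T_s, the bar involution, and c_s *)

Section HeckeTheory.
Variables (W : groupType) (S : set W) (L : W -> int).
Hypothesis WS : coxeter_system S.
Variable D : hecke_datum S L.
Implicit Types (w x y z : W) (h : hecke D).

Local Notation T := (stdb D).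
Local Notation C := (canb D).
Local Notation l := (len S).
Local Notation xi s := (vpow (L s) - vpow (- L s)).

Let sq := coxeter_sq WS.
Let ge := coxeter_gen WS.
Let bT : is_basis T := @stdb_basis _ _ _ D.

Lemma stdb1 : T 1 = 1.
Proof. by rewrite -[1%g](wprod_nil W) stdb_reduced ?big_nil //; apply: reduced_nil. Qed.

Lemma stdbM x y : l (x * y) = (l x + l y)%N -> T (x * y)%g = T x * T y.
Proof.
have [u [u1 u2] <-] := reduced_word sq ge x.
have [v [v1 v2] <-] := reduced_word sq ge y => hl.
rewrite -wprod_cat !stdb_reduced // ?big_cat //.
by split; [apply: word_cat | rewrite wprod_cat hl -u2 -v2 size_cat].
Qed.

Lemma len_generator s : S s -> l s = 1%N.
Proof.
move=> Ss; have [|] := len_gen_mul WS 1%g Ss; rewrite mulg1 len1 //.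
Qed.

Lemma len_mul_gen w s : S s -> l (w * s) = (l w).+1 \/ l w = (l (w * s)).+1.
Proof.
move=> Ss; have := len_gen_mul WS w^-1%g Ss.
by rewrite -(lenV sq ge (s * _)) invgM invgK (gensV sq Ss) (lenV sq ge).
Qed.

Lemma stdb_sq s : S s -> T s * T s = 1 + xi s *: T s.
Proof.
move=> Ss; have [[/(_ s Ss) + _] _] := @stdb_presentation _ _ _ D.
rewrite mulrDr !mulrBl -!scalerAl mul1r -!scalerAr mulr1 scalerA -vpowD subrr.
move=> h; apply/eqP; rewrite -subr_eq0 -[X in _ == X]h scale1r scalerBl mulr1.
rewrite !opprD opprK -!addrA; apply/eqP; congr (_ + _).
by rewrite addrCA; congr (_ + _); rewrite addrC.
Qed.

(** When s shortens w, splitting T_w as T_s T_(sw) brings in T_s^2. *)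
Lemma stdb_mull s w : S s ->
  T s * T w = T (s * w)%g + (if (l (s * w) < l w)%N then xi s *: T w else 0).
Proof.
move=> Ss; have [hl|hl] := len_gen_mul WS w Ss.
  by rewrite hl ltnNge leqnSn /= addr0 stdbM // (len_generator Ss) hl add1n.
rewrite [in (_ < l w)%N]hl ltnSn.
have Tw : T w = T s * T (s * w)%g.
  by rewrite -stdbM mulgA (sq Ss) mul1g // (len_generator Ss) add1n.
by rewrite [in LHS]Tw mulrA stdb_sq // mulrDl mul1r -scalerAl -Tw.
Qed.

Lemma stdb_mulr s w : S s ->
  T w * T s = T (w * s)%g + (if (l (w * s) < l w)%N then xi s *: T w else 0).
Proof.
move=> Ss; have [hl|hl] := len_mul_gen w Ss.
  by rewrite hl ltnNge leqnSn /= addr0 stdbM // (len_generator Ss) hl addn1.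
rewrite [in (_ < l w)%N]hl ltnSn.
have Tw : T w = T (w * s)%g * T s.
  by rewrite -stdbM -mulgA (sq Ss) mulg1 // (len_generator Ss) addn1.
by rewrite [in LHS]Tw -mulrA stdb_sq // mulrDr mulr1 -scalerAr -Tw.
Qed.

(** By the quadratic relation the right-hand side is an inverse of T_s, and so is bar(T_s). *)
Lemma bar_gen s : S s -> bar D (T s) = T s - (xi s)%:A.
Proof.
move=> Ss; have [_ h2] := @bar_stdb _ _ _ D s Ss; have [h1 _] := @bar_stdb _ _ _ D s Ss.
have h3 : T s * (T s - (xi s)%:A) = 1.
  by rewrite mulrBr stdb_sq // -scalerAr mulr1 addrK.
by rewrite -[LHS]mulr1 -[X in _ * X = _]h3 mulrA h1 mul1r.
Qed.

Lemma bar_vpow_gen (k : int) : bar D (vpow k)%:A = (vpow (- k))%:A.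
Proof.
have bv : bar D (vpow (-1))%:A = (vpow 1)%:A by rewrite -bar_v bar_involutive.
have E m n : (vpow (m + n))%:A = (vpow m)%:A * (vpow n)%:A :> hecke D.
  by rewrite vpowD -scalerAl mul1r scalerA.
have Bn (n : nat) : bar D (vpow n%:Z)%:A = (vpow (- n%:Z))%:A /\
    bar D (vpow (- n%:Z))%:A = (vpow n%:Z)%:A.
  elim: n => [|n [IH1 IH2]].
    by rewrite oppr0 -[vpow 0]/(1 : laurent) scale1r rmorph1.
  by rewrite -addn1 PoszD opprD !E !rmorphM /= IH1 IH2 bv bar_v.
by case: k => n; [case: (Bn n) | rewrite NegzE opprK; case: (Bn n.+1)].
Qed.

Lemma canonical_uniq w h : is_canonical T (bar D) w h -> C w = h.
Proof. by case: (@canb_canonical _ _ _ D w) => _; apply. Qed.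

Lemma canonicalP w : is_canonical T (bar D) w (C w).
Proof. by case: (@canb_canonical _ _ _ D w). Qed.

Lemma canb1 : C 1 = 1.
Proof.
apply: canonical_uniq; split; first exact: rmorph1.
  by rewrite -stdb1 (coord_b bT) eqxx.
by move=> y y1; rewrite -stdb1 (coord_b bT) (introF eqP (not_eq_sym y1)); apply: in_vZ0.
Qed.

Lemma canb_gen s : S s -> 0 < L s -> C s = T s + (vpow (- L s))%:A.
Proof.
move=> Ss Ls; apply: canonical_uniq; split.
- rewrite rmorphD /= bar_gen // bar_vpow_gen opprK scalerBl opprB.
  by rewrite -addrA addrNK.
- rewrite coordD // coordZ // -stdb1 !(coord_b bT) eqxx eq_sym.
  by rewrite (negbTE (coxeter_neq1 WS Ss)) mulr0 addr0.
- move=> y ys; rewrite coordD // coordZ // -stdb1 !(coord_b bT).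
  rewrite (introF eqP (not_eq_sym ys)) add0r; case: eqP => _; last first.
    by rewrite mulr0; apply: in_vZ0.
  rewrite mulr1.
  (* Positivity of L(s) places v^(-L(s)) in v^-1 Z[v^-1]. *)
  apply: in_vZ_le (@in_vZ_vpow _); lia.
Qed.

End HeckeTheory.

(** * The exchange condition *)

Section Exchange.
Variables (W : groupType) (S : set W) (L : W -> int).
Hypothesis WS : coxeter_system S.
Hypothesis L_pos : forall s, S s -> 0 < L s.
Variable D : hecke_datum S L.
Implicit Types (s t w : W) (u : seq W).

Local Notation T := (stdb D).
Local Notation l := (len S).

Let sq := coxeter_sq WS.
Let ge := coxeter_gen WS.
Let bT : is_basis T := @stdb_basis _ _ _ D.

(* Expand T_s T_w T_t in two ways. *)
Lemma len_exchange s t w : S s -> S t ->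
  l (s * w) = (l w).+1 -> l (w * t) = (l w).+1 ->
  (l (s * w * t) < l (s * w))%N -> (s * w = w * t)%g.
Proof.
move=> Ss St sw wt swt; have := mulrA (T s) (T w) (T t).
rewrite -(@stdbM _ _ _ WS D w t) ?(len_generator WS St) ?addn1 //.
rewrite -(@stdbM _ _ _ WS D s w) ?(len_generator WS Ss) ?add1n //.
rewrite (stdb_mull WS) // (stdb_mulr WS) // mulgA swt wt -sw swt.
(* The terms T_(swt) cancel and leave xi_s T_(wt) = xi_t T_(sw). If wt and sw differed, the
   coordinate at sw would give xi_t = 0, against L(t) > 0. *)
move=> /addrI /(congr1 (fun h => coord T h (s * w)%g)).
rewrite !(coordZ bT) !(coord_b bT) eqxx mulr1; case: eqP => [//|_].
by rewrite mulr0 => /esym/vpow_neq[]; have := L_pos St; lia.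
Qed.

(** The condition is extracted from the Hecke algebra through [len_exchange]. For u = s :: v, either
    t already shortens v and induction applies, or sv = vt and the deleted letter is s. *)
Lemma exchange u t : reduced S u -> S t ->
  (l (wprod u * t) < l (wprod u))%N ->
  exists2 i, (i < size u)%N & (wprod u * t)%g = wprod (take i u ++ drop i.+1 u).
Proof.
move=> + St; elim: u => [|s v IH] ru; first by rewrite wprod_nil len1.
have /word_consP[Ss _] := ru.1; have [rv sv] := reduced_behead sq ge ru.
rewrite wprod_cons => svt; have [vt|vt] := len_mul_gen WS (wprod v) St.
  exists 0%N => //; rewrite take0 drop1 /= (len_exchange Ss St sv vt svt).
  by rewrite -mulgA sq // mulg1.
have [|i iv vi] := IH rv; first by rewrite vt.
by exists i.+1 => //=; rewrite -mulgA vi wprod_cons.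
Qed.

End Exchange.

(** * The trace form, the anti-involution, and bounds on structure constants *)

Section HeckeSymmetry.
Variables (W : groupType) (S : set W) (L : W -> int).
Hypothesis WS : coxeter_system S.
Variable D : hecke_datum S L.
Implicit Types (w x y z : W) (g h : hecke D).

Local Notation T := (stdb D).
Local Notation C := (canb D).

Let sq := coxeter_sq WS.
Let ge := coxeter_gen WS.
Let bT : is_basis T := @stdb_basis _ _ _ D.
Let bC : is_basis C := @canb_basis _ _ _ D.

(** Induction on the length of x, moving one factor T_s to the right. With tau the coordinate at
    T_1, this makes T_x and T_(x^-1) dual bases for the form tau(g h). *)
Lemma coord_stdbM1 x y : coord T (T x^-1%g * T y) 1%g = (y == x)%:R.
Proof.
elim/(len_ind sq ge): x y => [|s x Ss hl IH] y.
  by rewrite invg1 (stdb1 D) mul1r (coord_b bT).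
have -> : T (s * x)^-1%g = T x^-1%g * T s.
  rewrite invgM (gensV sq Ss) (stdbM WS) //.
  by rewrite -{1}(gensV sq Ss) -invgM !(lenV sq ge) hl (len_generator WS Ss) addn1.
rewrite -mulrA (stdb_mull WS) // mulrDr (coordD bT) IH.
have -> : (s * y == x)%g = (y == s * x)%g.
  by apply/eqP/eqP => [<-|->]; rewrite mulgA sq // mul1g.
(* The correction term occurs when l(sy) < l(y) and contributes only for y = x, but l(sx) > l(x). *)
case: ifP => [lt|_]; last by rewrite mulr0 (coord0 bT) addr0.
rewrite -scalerAr (coordZ bT) IH; case: (y =P x) => [yx|_]; last by rewrite mulr0 addr0.
by move: lt; rewrite yx hl ltnNge leqnSn.
Qed.

Lemma coord_stdb_mul1 x h : coord T (T x * h) 1%g = coord T h x^-1%g.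
Proof.
move: h; apply: (basis_ind bT).
- by rewrite mulr0 !(coord0 bT).
- by move=> g h IH1 IH2; rewrite mulrDr !(coordD bT) IH1 IH2.
- by move=> p h IH; rewrite -scalerAr !(coordZ bT) IH.
- by move=> y; rewrite -{1}[x]invgK coord_stdbM1 (coord_b bT).
Qed.

Lemma coord_mul1 g h :
  coord T (g * h) 1%g =
    \sum_(u <- msupp (coords T g)) coord T g u * coord T h u^-1%g.
Proof.
rewrite {1}(coord_expand bT g) mulr_suml (coord_sum bT); apply: eq_bigr => u _.
by rewrite -scalerAl (coordZ bT) coord_stdb_mul1.
Qed.

(** This anti-involution fixes each T_s and reverses products; it transfers left-handed statements
    to right-handed ones. *)
Definition flat h : hecke D := blin T (fun w => T w^-1%g) h.

Lemma flatD g h : flat (g + h) = flat g + flat h.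
Proof. exact: (blinD bT). Qed.

Lemma flatZ p h : flat (p *: h) = p *: flat h.
Proof. exact: (blinZ bT). Qed.

Lemma flat0 : flat 0 = 0.
Proof. exact: (blin0 bT). Qed.

Lemma flatN h : flat (- h) = - flat h.
Proof. by rewrite -scaleN1r flatZ scaleN1r. Qed.

Lemma flat_stdb w : flat (T w) = T w^-1%g.
Proof. exact: (blin_b bT). Qed.

Lemma flat1 : flat 1 = 1.
Proof. by rewrite -(stdb1 D) flat_stdb invg1. Qed.

Lemma flat_gen s : S s -> flat (T s) = T s.
Proof. by move=> Ss; rewrite flat_stdb (gensV sq Ss). Qed.

(** For a factor T_s, the formulas for left and right multiplication correspond under inversion, as
    l(w^-1) = l(w). Linearity and induction on the length do the rest. *)
Lemma flatM g h : flat (g * h) = flat h * flat g.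
Proof.
have flat_sT s w : S s -> flat (T s * T w) = flat (T w) * T s.
  move=> Ss; rewrite (stdb_mull WS) // flatD !flat_stdb (stdb_mulr WS) // invgM.
  rewrite -(lenV sq ge (s * w)) -(lenV sq ge w) invgM (gensV sq Ss).
  by case: ifP => _; rewrite ?flat0 ?flatZ ?flat_stdb.
have flat_s s k : S s -> flat (T s * k) = flat k * T s.
  move=> Ss; move: k; apply: (basis_ind bT) => [|k1 k2 IH1 IH2|p k IH|w].
  - by rewrite mulr0 flat0 mul0r.
  - by rewrite mulrDr !flatD IH1 IH2 mulrDl.
  - by rewrite -scalerAr !flatZ IH scalerAl.
  - exact: flat_sT.
have flat_x x k : flat (T x * k) = flat k * flat (T x).
  elim/(len_ind sq ge): x k => [|s x Ss hl IH] k.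
    by rewrite (stdb1 D) mul1r flat1 mulr1.
  rewrite (stdbM WS) ?(len_generator WS Ss) //.
  by rewrite -mulrA !(flat_s s _ Ss) IH mulrA.
move: g; apply: (basis_ind bT) => [|k1 k2 IH1 IH2|p k IH|w].
- by rewrite mul0r flat0 mulr0.
- by rewrite mulrDl !flatD IH1 IH2 mulrDr.
- by rewrite -scalerAl !flatZ IH scalerAr.
- exact: flat_x.
Qed.

(** Both composites are additive, reverse products, and agree on v, v^-1 and every T_s. *)
Lemma flat_bar h : flat (bar D h) = bar D (flat h).
Proof.
have fA p : flat p%:A = p%:A by rewrite flatZ flat1.
move: h; apply: (hecke_ind sq ge).
- by move=> g h IH1 IH2; rewrite flatD !rmorphD flatD /= IH1 IH2.
- by move=> h IH; rewrite flatN !rmorphN flatN /= IH.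
- by move=> g h IH1 IH2; rewrite flatM !rmorphM flatM /= IH1 IH2.
- by rewrite flat1 !rmorph1 flat1.
- by rewrite fA bar_vpow_gen fA.
- by rewrite fA bar_vpow_gen fA.
- by move=> s Ss; rewrite flat_gen // bar_gen // flatD flatN flatZ flat_gen // flat1.
Qed.

Lemma coord_stdb_flat h w : coord T (flat h) w = coord T h w^-1%g.
Proof.
move: h; apply: (basis_ind bT) => [|g h IH1 IH2|p h IH|x].
- by rewrite flat0 !(coord0 bT).
- by rewrite flatD !(coordD bT) IH1 IH2.
- by rewrite flatZ !(coordZ bT) IH.
- by rewrite flat_stdb !(coord_b bT) (can2_eq (@invgK W) (@invgK W)).
Qed.

(** The image of c_w satisfies the conditions that characterize c_(w^-1). *)
Lemma flat_canb w : flat (C w) = C w^-1%g.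
Proof.
apply/esym/canonical_uniq; have [h1 h2 h3] := canonicalP D w; split.
- by rewrite -flat_bar h1.
- by rewrite coord_stdb_flat invgK.
- by move=> y yw; rewrite coord_stdb_flat; apply: h3 => yw'; apply: yw; rewrite -yw' invgK.
Qed.

Lemma coord_canb_flat h w : coord C (flat h) w = coord C h w^-1%g.
Proof.
move: h; apply: (basis_ind bC) => [|g h IH1 IH2|p h IH|x].
- by rewrite flat0 !(coord0 bC).
- by rewrite flatD !(coordD bC) IH1 IH2.
- by rewrite flatZ !(coordZ bC) IH.
- by rewrite flat_canb !(coord_b bC) (can2_eq (@invgK W) (@invgK W)).
Qed.

Lemma hcoefV x y z : hcoef D x y z = hcoef D y^-1%g x^-1%g z^-1%g.
Proof. by rewrite /hcoef -!flat_canb -flatM coord_canb_flat invgK. Qed.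

Lemma pcoef_inv1 z : pcoef D 1%g z^-1%g = pcoef D 1%g z.
Proof. by rewrite /pcoef -flat_canb coord_stdb_flat invg1. Qed.

Lemma pcoef_in_vZ y z : in_vZ 0 (pcoef D y z).
Proof.
have [_ h1 h2] := canonicalP D z; have [->|/eqP yz] := eqVneq y z.
  by rewrite /pcoef h1; apply: in_vZ1.
by apply: in_vZ_le (h2 y yz).
Qed.

Lemma lcoef_pcoef y z : lcoef 0 (pcoef D y z) = (y == z)%:R.
Proof.
have [_ h1 h2] := canonicalP D z; have [->|/eqP yz] := eqVneq y z.
  by rewrite /pcoef h1 lcoef1.
exact: (h2 y yz).
Qed.

Lemma hcoef_assoc x y z d :
  \sum_(u <- msupp (coords C (C x * C y))) hcoef D x y u * hcoef D u z d =
  \sum_(u <- msupp (coords C (C y * C z))) hcoef D y z u * hcoef D x u d.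
Proof.
transitivity (coord C (C x * C y * C z) d).
  rewrite [in RHS](coord_expand bC (C x * C y)) mulr_suml (coord_sum bC).
  by apply: eq_bigr => u _; rewrite -scalerAl (coordZ bC).
rewrite -mulrA [in LHS](coord_expand bC (C y * C z)) mulr_sumr (coord_sum bC).
by apply: eq_bigr => u _; rewrite -scalerAr (coordZ bC).
Qed.

Lemma hcoef_supp x y u : u \notin msupp (coords C (C x * C y)) -> hcoef D x y u = 0.
Proof. exact: mcoeff_outdom. Qed.

Lemma hcoef1 z : hcoef D 1%g z z = 1.
Proof. by rewrite /hcoef (canb1 D) mul1r (coord_b bC) eqxx. Qed.

(* Descending on the degree: in top degree the coordinates in the two bases
   agree, because p_{y,w} is delta_{y,w} modulo v^-1. *)
Lemma coord_canb_in_vZ (N : nat) h :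
  (forall w, in_vZ N%:Z (coord T h w)) -> forall w, in_vZ N%:Z (coord C h w).
Proof.
move=> hT.
(* Only finitely many coordinates are nonzero, so some excess M over N bounds all of them; the
   descent removes M one unit at a time. *)
have [M hM] : exists M : nat, forall w, in_vZ (N%:Z + M%:Z) (coord C h w).
  have hM (r : seq W) : exists M : nat, forall w, w \in r ->
      in_vZ M%:Z (coord C h w).
    elim: r => [|w r [M IH]]; first by exists 0%N.
    have [M' hM'] := in_vZ_bound (coord C h w); exists (maxn M M') => x.
    rewrite inE => /predU1P[->|/IH]; [apply: in_vZ_le hM'|apply: in_vZ_le]; lia.
  have {hM} [M hM] := hM (msupp (coords C h)).
  exists M => w; have [/hM|/mcoeff_outdom] := boolP (w \in msupp (coords C h)).
    by apply: in_vZ_le; lia.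
  by rewrite -coordE => ->; apply: in_vZ0.
elim: M hM => [|M IH] hM w; first by have := hM w; rewrite addr0.
apply: IH w => w; have EM : N%:Z + M.+1%:Z = N%:Z + M%:Z + 1 by lia.
apply: in_vZ_lead; rewrite -EM //.
have : lcoef (N%:Z + M.+1%:Z) (coord T h w) = 0 by apply: hT; lia.
rewrite {1}(coord_expand bC h) (coord_sum bT) lcoef_sum.
under eq_bigr => u _ do rewrite (coordZ bT) -[N%:Z + _]addr0
  (lcoefM (hM u) (@pcoef_in_vZ w u)) lcoef_pcoef.
rewrite (@sum_at _ _ _ _ w) ?fset_uniq // ?eqxx ?mulr1 //.
  by move=> u _ uw; rewrite eq_sym (negbTE uw) mulr0.
by move=> /mcoeff_outdom; rewrite -coordE => ->; rewrite lcoef0 ?mul0r.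
Qed.

(** Ensures that the minimum defining a(z) is attained. The p_(y,w) lie in Z[v^-1], so in the basis
    T the product c_x c_y obeys the bound on [fcoef], and passing to the basis c keeps it. *)
Lemma hcoef_bounded : bounded D ->
  exists N : nat, forall x y z, in_vZ N%:Z (hcoef D x y z).
Proof.
move=> [N hN]; exists N => x y; apply: coord_canb_in_vZ => w.
rewrite (coord_expand bT (C x)) mulr_suml (coord_sum bT).
apply: in_vZ_sum => u _; rewrite -scalerAl (coordZ bT) -[N%:Z]add0r.
apply: in_vZM; first exact: pcoef_in_vZ.
rewrite (coord_expand bT (C y)) mulr_sumr (coord_sum bT).
apply: in_vZ_sum => t _; rewrite -scalerAr (coordZ bT) -[N%:Z]add0r.
apply: in_vZM; first exact: pcoef_in_vZ.
have -> : coord T (T u * T t) w = vpow N%:Z * (vpow (- N%:Z) * fcoef D u t w).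
  by rewrite mulrA -vpowD subrr mul1r.
rewrite -[X in in_vZ X _]addr0; apply: in_vZM; first exact: in_vZ_vpow.
exact: hN.
Qed.

End HeckeSymmetry.

(** * The cell preorders, the function a, and Delta *)

Section CellTheory.
Variables (W : groupType) (S : set W) (L : W -> int).
Hypothesis WS : coxeter_system S.
Hypothesis L_pos : forall s, S s -> 0 < L s.
Variable D : hecke_datum S L.
Implicit Types (w x y z d u : W) (g h : hecke D).

Local Notation T := (stdb D).
Local Notation C := (canb D).
Local Notation a := (afun D).

Let sq := coxeter_sq WS.
Let ge := coxeter_gen WS.
Let bT : is_basis T := @stdb_basis _ _ _ D.
Let bC : is_basis C := @canb_basis _ _ _ D.

Lemma arrowL_pre z' z : arrowL D z' z -> preL D z' z.
Proof. exact: rt_step. Qed.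

Lemma preL_trans x y z : preL D x y -> preL D y z -> preL D x z.
Proof. exact: rt_trans. Qed.

Lemma arrowR_inv z' z : arrowR D z' z <-> arrowL D z'^-1%g z^-1%g.
Proof.
split=> -[s Ss nz]; exists s => //; move: nz;
by rewrite -(coord_canb_flat WS) (flatM WS) !(flat_canb WS) ?invgK (gensV sq Ss).
Qed.

Lemma preR_inv z' z : preR D z' z <-> preL D z'^-1%g z^-1%g.
Proof.
split=> [|h].
  elim=> [x y /arrowR_inv|x|x y t _ h1 _ h2].
  - exact: rt_step.
  - exact: rt_refl.
  - exact: rt_trans h1 h2.
rewrite -[z']invgK -[z]invgK; elim: h => [x y xy|x|x y t _ h1 _ h2].
- by apply: rt_step; apply/arrowR_inv; rewrite !invgK.
- exact: rt_refl.
- exact: rt_trans h1 h2.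
Qed.

Lemma preL_LR z' z : preL D z' z -> preLR D z' z.
Proof.
elim=> [x y xy|x|x y t _ h1 _ h2].
- by apply: rt_step; left.
- exact: rt_refl.
- exact: rt_trans h1 h2.
Qed.

Lemma preR_LR z' z : preR D z' z -> preLR D z' z.
Proof.
elim=> [x y xy|x|x y t _ h1 _ h2].
- by apply: rt_step; right.
- exact: rt_refl.
- exact: rt_trans h1 h2.
Qed.

(* The span of the c_z with z <=_L y is a left ideal, since the c_s and the
   scalars generate the algebra. *)
Lemma hcoef_preL x y z : hcoef D x y z <> 0 -> preL D z y.
Proof.
pose M h := forall w, coord C h w <> 0 -> preL D w y.
have M0 : M 0 by move=> w; rewrite (coord0 bC).
have MD g h : M g -> M h -> M (g + h).
  move=> hg hh w; rewrite (coordD bC) => gh.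
  have [g0|/eqP/hg//] := eqVneq (coord C g w) 0.
  by apply: hh => h0; apply: gh; rewrite g0 h0 addr0.
have MZ p h : M h -> M (p *: h).
  by move=> hh w; rewrite (coordZ bC) => ph; apply: hh => h0; apply: ph; rewrite h0 mulr0.
have MC s h : S s -> M h -> M (C s * h).
  move=> Ss hh; rewrite (coord_expand bC h) mulr_sumr.
  rewrite big_seq; apply: (big_ind M) => // w; rewrite -coord_neq0 => /eqP/hh wy.
  rewrite -scalerAr; apply: MZ => u uw.
  by apply: preL_trans wy; apply: arrowL_pre; exists s.
pose Q g := forall h, M h -> M (g * h).
have Qall g : Q g.
  move: g; apply: (hecke_ind sq ge).
  - by move=> g1 g2 h1 h2 h hh; rewrite mulrDl; apply: MD; [apply: h1|apply: h2].
  - by move=> g hg h hh; rewrite mulNr -scaleN1r; apply/MZ/hg.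
  - by move=> g1 g2 h1 h2 h hh; rewrite -mulrA; apply/h1/h2.
  - by move=> h; rewrite mul1r.
  - by move=> h hh; rewrite -scalerAl mul1r; apply: MZ.
  - by move=> h hh; rewrite -scalerAl mul1r; apply: MZ.
  - move=> s Ss h hh; have -> : T s = C s - (vpow (- L s))%:A.
      by rewrite (canb_gen WS) ?addrK // L_pos.
    rewrite mulrBl -scalerAl mul1r -scaleNr; apply: MD; first exact: MC.
    exact: MZ.
apply: Qall => w; rewrite (coord_b bC).
by case: eqP => // <- _; apply: rt_refl.
Qed.

Lemma hcoef_preR x y z : hcoef D x y z <> 0 -> preR D z x.
Proof. by rewrite (hcoefV WS) => /hcoef_preL /preR_inv. Qed.

Hypothesis D_bounded : bounded D.

Lemma afunP z : (forall x y, in_vZ (a z)%:Z (hcoef D x y z)) /\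
  forall n : nat, (forall x y, in_vZ n%:Z (hcoef D x y z)) -> (a z <= n)%N.
Proof.
apply: (@least_spec (fun n : nat => forall x y, in_vZ n%:Z (hcoef D x y z))).
by have [N hN] := hcoef_bounded D_bounded; exists N.
Qed.

Lemma hcoef_in_vZ x y z : in_vZ (a z)%:Z (hcoef D x y z).
Proof. by have [h _] := afunP z; apply: h. Qed.

(** The descending induction of [afun_gamma_Dset] rests on this uniform bound. *)
Lemma afun_bounded : exists N : nat, forall z, (a z <= N)%N.
Proof.
have [N hN] := hcoef_bounded D_bounded; exists N => z.
by have [_] := afunP z; apply.
Qed.

Lemma afunV z : a z^-1%g = a z.
Proof.
suff le x : (a x^-1%g <= a x)%N by apply/eqP; rewrite eqn_leq le -{1}[z]invgK le.
have [_] := afunP x^-1%g; apply=> u v; rewrite (hcoefV WS) invgK.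
exact: hcoef_in_vZ.
Qed.

Lemma gammaV x y z : gamma D x y z = gamma D y^-1%g x^-1%g z^-1%g.
Proof. by rewrite /gamma invgK afunV (hcoefV WS) invgK. Qed.

Lemma gamma_hcoef x y z : gamma D x y z <> 0 -> hcoef D x y z^-1%g <> 0.
Proof. by rewrite /gamma => g h; apply: g; rewrite h lcoef0. Qed.

(** If all these top coefficients vanished, the degree bound would drop by one, against minimality
    of a. When a = 0 no smaller natural number is available, and h_(1,w,w) = 1 is used instead. *)
Lemma gamma_exists z : exists x y, gamma D x y z <> 0.
Proof.
have [_ amin] := afunP z^-1%g; rewrite /gamma; case E: (a z^-1%g) amin => [|n] amin.
  by exists 1%g, z^-1%g; rewrite hcoef1 lcoef1 eqxx.
apply: contrapT => no; suff: (n.+1 <= n)%N by rewrite ltnn.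
apply: amin => x y; apply: in_vZ_lead.
  by have := @hcoef_in_vZ x y z^-1%g; rewrite E -addn1 PoszD.
by apply: contrapT => xy; apply: no; exists x, y; rewrite -addn1 PoszD.
Qed.

(** If p_(1,z) is zero, every bound holds, the default value of [Delta] included. Otherwise all
    exponents are nonpositive, and the least n with a nonzero coefficient at v^(-n) gives the
    degree. *)
Lemma Delta_in_vZ z : in_vZ (- (Delta D z)%:Z) (pcoef D 1%g z).
Proof.
have [->|p0] := eqVneq (pcoef D 1%g z) 0; first exact: in_vZ0.
rewrite /Delta; case: xgetP => [n _ []//|no].
have p_low := @pcoef_in_vZ _ _ _ D 1%g z.
have exn : exists n : nat, lcoef (- n%:Z) (pcoef D 1%g z) != 0.
  apply: contrapT => no'; move/negP: p0; apply; apply/eqP/laurent_eq0P => k.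
  have [k0|k0] := ltP 0 k; first exact: p_low.
  apply: contrapT => /eqP pk; apply: no'; exists (absz k).
  by rewrite (_ : - _ = k) //; lia.
case: (ex_minnP exn) => n pn n_min; have [] := no n; split; first exact/eqP.
move=> k nk; have [k0|k0] := ltP 0 k; first exact: p_low.
apply: contrapT => /eqP pk; have := n_min (absz k).
rewrite (_ : - _ = k); last by lia.
by move=> /(_ pk); lia.
Qed.

Lemma DeltaV z : Delta D z^-1%g = Delta D z.
Proof. by rewrite /Delta (pcoef_inv1 WS). Qed.

Lemma DsetV d : Dset D d -> Dset D d^-1%g.
Proof. by rewrite /Dset /= afunV DeltaV. Qed.

Lemma ncoefV z : ncoef D z^-1%g = ncoef D z.
Proof. by rewrite /ncoef DeltaV (pcoef_inv1 WS). Qed.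

(** In the sum of p_(u,y^-1) p_(u^-1,y) over u, only u = y^-1 yields a constant term, because every
    other p_(u,y^-1) lies in v^-1 Z[v^-1]. *)
Lemma lcoef_canbV y : lcoef 0 (coord T (C y^-1%g * C y) 1%g) = 1.
Proof.
rewrite (coord_mul1 WS) lcoef_sum.
under eq_bigr => u _ do rewrite -[X in lcoef X _]addr0
  (lcoefM (@pcoef_in_vZ _ _ _ D u y^-1%g) (@pcoef_in_vZ _ _ _ D u^-1%g y)) !lcoef_pcoef.
rewrite (@sum_at _ _ _ _ y^-1%g) ?fset_uniq // ?invgK ?eqxx ?mulr1 //.
  by move=> u _ uw; rewrite (negbTE uw) mul0r.
by rewrite -coord_neq0 -/(pcoef D _ _) => /negPn/eqP py;
have := lcoef_pcoef D y^-1%g y^-1%g; rewrite py lcoef0 eqxx => <-.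
Qed.

End CellTheory.

(** * Properties P4 to P11, P13 and P14 *)

Section Implications.
Variables (W : groupType) (S : set W) (L : W -> int).
Hypothesis WS : coxeter_system S.
Hypothesis L_pos : forall s, S s -> 0 < L s.
Variable D : hecke_datum S L.
Hypothesis D_bounded : bounded D.
Implicit Types (w x y z d u : W).

Local Notation T := (stdb D).
Local Notation C := (canb D).
Local Notation a := (afun D).

Let bT : is_basis T := @stdb_basis _ _ _ D.
Let bC : is_basis C := @canb_basis _ _ _ D.

Section P4.
Hypothesis hPtilde : Ptilde D.

Lemma afun_preL z' z : preL D z' z -> (a z <= a z')%N.
Proof.
elim=> [z1 z2 h|//|x y t _ h1 _ h2]; last exact: leq_trans h2 h1.
have [x [y xy]] := gamma_exists D_bounded z2^-1%g.
by case: (hPtilde xy h).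
Qed.

Lemma afun_preR z' z : preR D z' z -> (a z <= a z')%N.
Proof. by move/(preR_inv WS)/afun_preL; rewrite !(afunV WS D_bounded). Qed.

Lemma afun_preLR z' z : preLR D z' z -> (a z <= a z')%N.
Proof.
elim=> [z1 z2 [h|h]|//|x y t _ h1 _ h2]; last exact: leq_trans h2 h1.
- by apply/afun_preL/rt_step.
- by apply/afun_preR/rt_step.
Qed.

Lemma P4_holds : P4 D.
Proof.
split=> [|z' z [h1 h2]]; first exact: afun_preLR.
by apply/eqP; rewrite eqn_leq !afun_preLR.
Qed.

End P4.

Hypotheses (hP1 : P1 D) (hP2 : P2 D) (hP3 : P3 D).

Lemma P3_uniq y d d' : Dset D d -> gamma D y^-1%g y d <> 0 ->
  Dset D d' -> gamma D y^-1%g y d' <> 0 -> d = d'.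
Proof. by move=> *; have [e [_ eu]] := hP3 y; rewrite -(eu d) // -(eu d'). Qed.

(** Some gamma_(x,y,d) is nonzero, and P2 forces x = y^-1. *)
Lemma Dset_gamma d : Dset D d -> exists y, gamma D y^-1%g y d <> 0.
Proof.
move=> Dd; have [x [y xy]] := gamma_exists D_bounded d.
by exists y; rewrite -(hP2 Dd xy).
Qed.

(** The anti-involution gives gamma_(y^-1,y,d) = gamma_(y^-1,y,d^-1), so uniqueness in P3 identifies
    d with d^-1. *)
Lemma DsetVid d : Dset D d -> d^-1%g = d.
Proof.
move=> Dd; have [y yd] := Dset_gamma Dd; apply: (P3_uniq _ _ Dd yd).
  exact: DsetV.
by move: yd; rewrite (gammaV WS D_bounded) !invgK.
Qed.

Lemma P6_holds : P6 D.
Proof. by move=> d Dd; rewrite expg2 -{1}(DsetVid Dd) mulVg. Qed.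

(* Compare the constant coefficients in
   tau(c_{y^-1} c_y) = \sum_z h_{y^-1,y,z} p_{1,z}. *)
Lemma gamma_ncoef d y : Dset D d -> gamma D y^-1%g y d <> 0 ->
  gamma D y^-1%g y d * ncoef D d = 1.
Proof.
move=> Dd yd; rewrite -[RHS](lcoef_canbV WS D y).
rewrite (coord_expand bC (C y^-1%g * C y)) (coord_sum bT) lcoef_sum.
(* The factors have degree at most a(z) and -Delta(z). By P1 a constant term can arise only if these
   add up to 0, that is, for z in [Dset]. *)
have term z : lcoef 0 (hcoef D y^-1%g y z * pcoef D 1%g z) =
    if a z == Delta D z then gamma D y^-1%g y z^-1%g * ncoef D z else 0.
  case: eqP => [aD|aD].
    rewrite /gamma invgK /ncoef -aD -lcoefM ?subrr //; first exact: hcoef_in_vZ.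
    by rewrite aD; apply: Delta_in_vZ.
  have := in_vZM (@hcoef_in_vZ _ _ _ D D_bounded y^-1%g y z) (@Delta_in_vZ _ _ _ D z).
  by apply; have := hP1 z; lia.
under eq_bigr => z _ do rewrite (coordZ bT) -/(hcoef D _ _ z) -/(pcoef D _ z) term.
(* By P3 the only surviving index is z = d^-1. *)
rewrite (@sum_at _ _ _ _ d^-1%g) ?fset_uniq //.
- rewrite invgK; have := DsetV WS D_bounded Dd.
  by rewrite /Dset /= => ->; rewrite eqxx (ncoefV WS).
- move=> z _ zd; case: eqP => // aD.
  have [->|/eqP yz] := eqVneq (gamma D y^-1%g y z^-1%g) 0; first by rewrite mul0r.
  have Dz : Dset D z^-1%g by apply: (DsetV WS D_bounded).
  by move: zd; rewrite (P3_uniq Dd yd Dz yz) invgK eqxx.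
- by move=> /hcoef_supp hd; case: yd; rewrite /gamma hd lcoef0.
Qed.

(** Two integers with product 1 are equal, and both are 1 or -1. *)
Lemma P5_holds : P5 D.
Proof.
move=> d y Dd yd; have := gamma_ncoef Dd yd.
move: (gamma D _ _ _) (ncoef D d) => g n gn.
have /eqP := congr1 absz gn; rewrite abszM muln_eq1 => /andP[/eqP ? /eqP ?].
by have [?|?] : n = 1 \/ n = -1; [lia|subst; lia..].
Qed.

Hypothesis hPtilde : Ptilde D.

(** Meant for n = a(d) and q one of h_(u,z,d^-1), h_(x,u,d^-1): if q is nonzero, monotonicity of a
    yields a(u) <= n. *)
Lemma lcoef_hcoefM (n : nat) x y u (q : laurent) :
  (q <> 0 -> (a u <= n)%N) -> in_vZ n%:Z q ->
  lcoef (n%:Z + n%:Z) (hcoef D x y u * q) = lcoef n%:Z (hcoef D x y u) * lcoef n%:Z q.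
Proof.
move=> un hq; have [->|/eqP/un {}un] := eqVneq q 0; first by rewrite mulr0 !lcoef0 mulr0.
by apply: lcoefM => //; apply: in_vZ_le (@hcoef_in_vZ _ _ _ D D_bounded x y u).
Qed.

Lemma gammaE n x y z : a z = n -> lcoef n%:Z (hcoef D x y z^-1%g) = gamma D x y z.
Proof. by move=> <-; rewrite /gamma (afunV WS D_bounded). Qed.

(* Coefficients of v^(2 a(d)) in (c_x c_y) c_z = c_x (c_y c_z) at c_{d^-1}. *)
Lemma gamma_cycle_of_afun x y z d : Dset D d -> gamma D x y z <> 0 ->
  gamma D z^-1%g z d <> 0 -> a d = a z -> gamma D x y z = gamma D y z x.
Proof.
move=> Dd xyz zd dz; pose n := a d.
have aVn : a d^-1%g = n by rewrite (afunV WS D_bounded).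
have hd u v : in_vZ n%:Z (hcoef D u v d^-1%g) by rewrite -aVn; apply: hcoef_in_vZ.
have leR u v : hcoef D u v d^-1%g <> 0 -> (a u <= n)%N.
  by move=> /(hcoef_preR WS L_pos)/(afun_preR hPtilde); rewrite aVn.
have leL u v : hcoef D u v d^-1%g <> 0 -> (a v <= n)%N.
  by move=> /(hcoef_preL WS L_pos)/(afun_preL hPtilde); rewrite aVn.
have := congr1 (lcoef (n%:Z + n%:Z)) (hcoef_assoc D x y z d^-1%g).
rewrite !lcoef_sum.
under eq_bigr => u _ do
  rewrite (lcoef_hcoefM _ _ (@leR u z) (@hd u z)) (gammaE _ _ (erefl n)).
under [in RHS]eq_bigr => u _ do
  rewrite (lcoef_hcoefM _ _ (@leL x u) (@hd x u)) (gammaE _ _ (erefl n)).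
rewrite (@sum_at _ _ _ _ z^-1%g) ?fset_uniq //; first last.
- by move=> /hcoef_supp ->; rewrite lcoef0 mul0r.
- move=> u _ uz; have [->|/eqP uzd] := eqVneq (gamma D u z d) 0; first exact: mulr0.
  by move: uz; rewrite (hP2 Dd uzd) eqxx.
rewrite (@sum_at _ _ _ _ x^-1%g) ?fset_uniq //; first last.
- by move=> /hcoef_supp ->; rewrite lcoef0 mul0r.
- move=> u _ ux; have [->|/eqP xud] := eqVneq (gamma D x u d) 0; first exact: mulr0.
  by move: ux; rewrite (hP2 Dd xud) invgK eqxx.
(* On the right, the coefficient of v^n in h_(y,z,x^-1) can be read as gamma_(y,z,x) only once a(x)
   = n is known. *)
rewrite (gammaE _ _ (esym dz)) => E.
have E0 : gamma D x y z * gamma D z^-1%g z d <> 0.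
  by move/eqP; rewrite mulf_eq0 => /orP[/eqP|/eqP].
have xd : gamma D x x^-1%g d <> 0 by move=> xd; apply: E0; rewrite E xd mulr0.
have yzx : lcoef n%:Z (hcoef D y z x^-1%g) <> 0.
  by move=> yzx; apply: E0; rewrite E yzx mul0r.
(* Nonvanishing of h_(x,x^-1,d^-1) gives a(x) <= n, and the nonzero coefficient of v^n in
   h_(y,z,x^-1) gives the converse. *)
have ax : a x = n.
  apply/eqP; rewrite eqn_leq (leR _ _ (gamma_hcoef xd)) /= leqNgt; apply/negP => xn.
  apply: yzx; apply: (@hcoef_in_vZ _ _ _ D D_bounded y z x^-1%g).
  by rewrite (afunV WS D_bounded).
have xd' : gamma D x^-1^-1%g x^-1%g d <> 0 by rewrite invgK.
(* By P5 both factors gamma_(z^-1,z,d) and gamma_(x,x^-1,d) equal n_d, which is 1 or -1, and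
   cancel. *)
have [xdn nd] := P5_holds Dd xd'; have [zdn _] := P5_holds Dd zd.
rewrite invgK in xdn; move: E; rewrite (gammaE _ _ ax) zdn xdn.
by case: nd => ->; lia.
Qed.

(* Descending induction on a(z), which is bounded. *)
Lemma afun_gamma_Dset z d : Dset D d -> gamma D z^-1%g z d <> 0 -> a d = a z.
Proof.
have [N aN] := afun_bounded D_bounded.
have [k] := ubnP (N - a z)%N; elim: k z d => // k IH z d kz Dd zd.
have le_zd : (a z <= a d)%N.
  have := afun_preL hPtilde (hcoef_preL WS L_pos (gamma_hcoef zd)).
  by rewrite (afunV WS D_bounded).
apply/eqP; rewrite eqn_leq le_zd andbT leqNgt; apply/negP => lt_zd.
(* Since a(d) > a(z), the induction hypothesis applies to d. It allows the cyclic shift to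
   gamma_(z,d,z^-1), whence z <=_L d and a(d) <= a(z), a contradiction. *)
have [d' [[Dd' dd'] _]] := hP3 d.
have ad' : a d' = a d by apply: IH => //; have := aN d; lia.
have zdz : gamma D z d z^-1%g <> 0.
  by rewrite -(gamma_cycle_of_afun Dd' zd dd' ad').
have := afun_preL hPtilde (hcoef_preL WS L_pos (gamma_hcoef zdz)).
by rewrite invgK leqNgt lt_zd.
Qed.

Lemma gamma_cycle_neq0 x y z : gamma D x y z <> 0 -> gamma D x y z = gamma D y z x.
Proof.
move=> xyz; have [d [[Dd zd] _]] := hP3 z.
exact: (gamma_cycle_of_afun Dd xyz zd (afun_gamma_Dset Dd zd)).
Qed.

(** [gamma_cycle_neq0] needs a nonzero starting term. From a nonzero gamma_(y,z,x), two shifts lead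
    back to gamma_(x,y,z); if gamma_(y,z,x) vanishes, so must gamma_(x,y,z). *)
Lemma P7_holds : P7 D.
Proof.
move=> x y z; have [yzx|/eqP yzx] := eqVneq (gamma D y z x) 0; last first.
  have e := gamma_cycle_neq0 yzx; rewrite e; apply/esym/gamma_cycle_neq0.
  by rewrite -e.
rewrite yzx; apply: contrapT => xyz; apply: (xyz).
by rewrite (gamma_cycle_neq0 xyz).
Qed.

(** A nonzero h_(x,y,z^-1) gives z^-1 <=_L y and, by inversion of <=_R, z <=_L x^-1. The three
    cyclic shifts supply all six relations. *)
Lemma P8_holds : P8 D.
Proof.
have half x y z : gamma D x y z <> 0 -> preL D z^-1%g y /\ preL D z x^-1%g.
  move=> /gamma_hcoef h; split; first exact: hcoef_preL h.
  by have /(preR_inv WS) := hcoef_preR WS L_pos h; rewrite invgK.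
move=> x y z xyz; have yzx := xyz; rewrite P7_holds in yzx.
have zxy := yzx; rewrite P7_holds in zxy.
by have [? ?] := half _ _ _ xyz; have [? ?] := half _ _ _ yzx; have [? ?] := half _ _ _ zxy.
Qed.

(** For one arrow, P~ turns gamma_(x,y,z^-1) into a coefficient of h_(x',y,z') that equals
    gamma_(x',y,z'^-1), as a(z') = a(z). By P8 both z and z' then lie in the left cell of y. *)
Lemma P9_holds : P9 D.
Proof.
move=> z' z z'z az; split=> //; elim: z'z az => [{z'}z' {}z h|x _|x y t h1 IH1 h2 IH2].
- move=> az; have [x [y xyz]] := gamma_exists D_bounded z^-1%g.
  have [[x' hx'] _] := hPtilde xyz h.
  have [_ [_ zy] _] := P8_holds xyz.
  have x'yz' : gamma D x' y z'^-1%g <> 0 by rewrite /gamma invgK az.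
  have [_ [yz' _] _] := P8_holds x'yz'.
  by move: zy yz'; rewrite !invgK; apply: rt_trans.
- exact: rt_refl.
(* By monotonicity a is constant along the chain, so both parts satisfy the induction hypothesis. *)
- move=> xt; have := afun_preL hPtilde h1; have := afun_preL hPtilde h2.
  by move=> l1 l2; apply: (@rt_trans _ _ _ y); [apply: IH2|apply: IH1]; lia.
Qed.

Lemma P10_holds : P10 D.
Proof.
move=> z' z z'z az; split=> //; apply/(preR_inv WS).
have /(preR_inv WS) h := z'z.
by have [] := P9_holds h; rewrite ?(afunV WS D_bounded).
Qed.

Lemma P11_holds : P11 D.
Proof.
move=> z' z z'z az; split=> //.
elim: z'z az => [{z'}z' {}z [h|h]|x _|x y t h1 IH1 h2 IH2].
- by move=> az; apply: preL_LR; have [] := P9_holds (rt_step _ _ _ _ h) az.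
- by move=> az; apply: preR_LR; have [] := P10_holds (rt_step _ _ _ _ h) az.
- exact: rt_refl.
- move=> xt; have := afun_preLR hPtilde h1; have := afun_preLR hPtilde h2.
  by move=> l1 l2; apply: (@rt_trans _ _ _ y); [apply: IH2|apply: IH1]; lia.
Qed.

Lemma Dset_simL x d : Dset D d -> gamma D x^-1%g x d <> 0 -> simL D x d.
Proof. by move=> Dd /P8_holds[_ + _]; rewrite (DsetVid Dd). Qed.

(** P7 rewrites the hypothesis as gamma_(x,d,x^-1), P~ carries it along an arrow to some
    gamma_(u,d,x'^-1), P7 shifts back to gamma_(x'^-1,u,d), and P2 gives u = x'. *)
Lemma Dset_preL x' x d : preL D x' x -> a x' = a x -> Dset D d ->
  gamma D x^-1%g x d <> 0 -> gamma D x'^-1%g x' d <> 0.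
Proof.
move=> + + Dd; elim=> [{}x' {}x h|//|x1 x2 x3 h1 IH1 h2 IH2].
  move=> ax xd; have xdx : gamma D x d x^-1%g <> 0 by rewrite -P7_holds.
  have [[u hu] _] := hPtilde xdx h.
  have x'ud : gamma D x'^-1%g u d <> 0 by rewrite P7_holds /gamma invgK ax.
  by have /invg_inj x'u := hP2 Dd x'ud; rewrite -x'u in x'ud.
move=> ax x3d; have := afun_preL hPtilde h1; have := afun_preL hPtilde h2.
by move=> l1 l2; apply: IH1; [|apply: IH2]; lia || idtac.
Qed.

Lemma afun_simL x y : simL D x y -> a x = a y.
Proof. by move=> [xy yx]; apply/eqP; rewrite eqn_leq !(afun_preL hPtilde). Qed.

(** Some y with gamma_(y^-1,y,d) nonzero lies in the left cell of d, and [Dset_preL] transports this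
    from y to d. *)
Lemma Dset_self d : Dset D d -> gamma D d^-1%g d d <> 0.
Proof.
move=> Dd; have [y yd] := Dset_gamma Dd; have yd_sim := Dset_simL Dd yd.
by apply: Dset_preL yd => //; [case: yd_sim | rewrite (afun_simL yd_sim)].
Qed.

(** The element d is the one P3 attaches to w. Any other candidate d' has both gamma_(d'^-1,d',d')
    and gamma_(d'^-1,d',d) nonzero, so P3 gives d' = d. *)
Lemma P13_holds : P13 D.
Proof.
move=> _ [w ->]; have [d [[Dd wd] _]] := hP3 w.
have inC x : simL D x w -> gamma D x^-1%g x d <> 0.
  by move=> xw; apply: Dset_preL wd => //; [case: xw | apply: afun_simL].
exists d; split=> //; first by split=> //; have [] := Dset_simL Dd wd.
move=> d' d'w Dd'; apply: (P3_uniq Dd' (Dset_self Dd') Dd).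
exact: inC.
Qed.

(** With z ~_L d and d^-1 = d, inversion gives z^-1 ~_R d, and d links z to z^-1. *)
Lemma P14_holds : P14 D.
Proof.
move=> z; have [d [[Dd zd] _]] := hP3 z.
have [h1 h2] := Dset_simL Dd zd.
have VR x y : preL D x y -> preR D x^-1%g y^-1%g by rewrite (preR_inv WS) !invgK.
have := VR _ _ h1; have := VR _ _ h2; rewrite (DsetVid Dd) => r1 r2; split.
- exact: rt_trans (preL_LR h1) (preR_LR r1).
- exact: rt_trans (preR_LR r2) (preL_LR h2).
Qed.

End Implications.

(** * Parabolic subgroups and P12 *)

Section Parabolic.
Variables (W : groupType) (S : set W) (L : W -> int).
Hypothesis WS : coxeter_system S.
Hypothesis L_pos : forall s, S s -> 0 < L s.
Variables (D : hecke_datum S L) (I : set W).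
Hypothesis IS : I `<=` S.
Variable DI : hecke_datum (pgens I) (fun w : parabolic I => L (pval w)).
Implicit Types (x y z w : parabolic I) (u : seq (parabolic I)).

Local Notation SI := (pgens I).

Let sq := coxeter_sq WS.

Lemma pval_inj : injective (@pval W I).
Proof. exact: val_inj. Qed.

Lemma pval1 : pval (1 : parabolic I)%g = 1%g.
Proof. exact: (gmulf1 (s := val)). Qed.

Lemma pvalM x y : pval (x * y)%g = (pval x * pval y)%g.
Proof. exact: (gmulfM (s := val)). Qed.

Lemma pvalV x : pval x^-1%g = (pval x)^-1%g.
Proof. by apply: (mulgI (pval x)); rewrite -pvalM !mulgV pval1. Qed.

Lemma pvalX x n : pval (x ^+ n)%g = (pval x ^+ n)%g.
Proof. by elim: n => [|n IH]; rewrite ?expg0 ?pval1 // !expgS pvalM IH. Qed.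

Lemma pval_wprod u : pval (wprod u) = wprod (map (@pval W I) u).
Proof.
by elim: u => [|s u IH]; rewrite /= ?wprod_nil ?pval1 // !wprod_cons pvalM IH.
Qed.

Lemma pval_gen_set w : gen I (pval w).
Proof. by have := valP w; rewrite !inE. Qed.

Lemma parabolic_sq s : SI s -> (s * s = 1)%g.
Proof. by move=> /IS/sq e; apply: pval_inj; rewrite pvalM e pval1. Qed.

Lemma parabolic_gen w : gen SI w.
Proof.
move=> A [[A1 AM AV] IA].
suff: [set v | exists2 x, A x & pval x = v] (pval w) by move=> [x Ax /pval_inj <-].
apply: pval_gen_set; split; first split.
- by exists 1%g; rewrite ?pval1.
- by move=> _ _ [x Ax <-] [y Ay <-]; exists (x * y)%g; rewrite ?pvalM //; apply: AM.
- by move=> _ [x Ax <-]; exists x^-1%g; rewrite ?pvalV //; apply: AV.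
move=> s Is; have sI : s \in in_gen I.
  by rewrite !inE => B [_ IB]; apply: IB.
by exists (Parabolic sI) => //; apply: IA.
Qed.

Lemma has_order_pval x n : has_order x n -> has_order (pval x) n.
Proof.
move=> [n0 xn x_min]; split=> // [|k kn]; first by rewrite -pvalX xn pval1.
by rewrite -pvalX -pval1 => /pval_inj; apply: x_min.
Qed.

Lemma word_pval u : word SI u -> word S (map (@pval W I) u).
Proof. by move=> hu _ /mapP[s /hu/IS Ss ->]. Qed.

(** Induction on the last letter t: if t did not lengthen the prefix v in W, the exchange condition
    would express vt by v with a letter deleted, a word in I too short for a reduced vt. *)
Lemma reduced_pval u : reduced SI u -> reduced S (map (@pval W I) u).
Proof.
elim/last_ind: u => [|v t IH] ru; first exact: reduced_nil.
have [] := ru; rewrite -cats1 => hw sz.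
have hv : word SI v by move=> s sv; apply: hw; rewrite mem_cat sv.
have ht : SI t by apply: hw; rewrite mem_cat inE eqxx orbT.
have psq := parabolic_sq; have pge := parabolic_gen.
rewrite wprod_cat wprod_cons wprod_nil mulg1 size_cat addn1 in sz.
have rv : reduced SI v.
  split=> //; apply/eqP; rewrite eqn_leq len_le // andbT.
  by have := lenM psq pge (wprod v) t; have := len_gen ht; lia.
have rm := IH rv; have [_ szv] := rm; have St := IS ht.
split; first exact: word_pval.
rewrite map_cat wprod_cat /= wprod_cons wprod_nil mulg1 size_cat /= addn1.
rewrite size_map in szv *.
have [->|lt] := len_mul_gen WS (wprod (map (@pval W I) v)) St; first by rewrite -szv.
have [|i iv E] := exchange WS L_pos D rm St; first by rewrite lt.
suff : (len SI (wprod v * t)%g <= (size v).-1)%N.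
  by rewrite -sz ltnNge leq_pred.
have -> : (wprod v * t)%g = wprod (take i v ++ drop i.+1 v).
  by apply: pval_inj; rewrite pvalM !pval_wprod E map_cat map_take map_drop.
apply: leq_trans (len_le _) _.
  by move=> s; rewrite mem_cat => /orP[/mem_take|/mem_drop] /hv.
rewrite size_map in iv; rewrite size_cat size_take size_drop iv.
by move: iv; case: (size v) => [|n] /=; lia.
Qed.

(** The T_s with s in I satisfy the relations of the smaller algebra, so its presentation yields the
    morphism. It respects every T_w because reduced words of W_I stay reduced in W. *)
Lemma hecke_embedding : exists phi : {lrmorphism hecke DI -> hecke D},
  forall w, phi (stdb DI w) = stdb D (pval w).
Proof.
have [_ /(_ (hecke D) (fun w => stdb D (pval w)))] := @stdb_presentation _ _ _ DI.
case.
  have [[quad br] _] := @stdb_presentation _ _ _ D.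
  split=> [s /IS|s s' m Is Is' ss' o]; first exact: quad.
  apply: br; [exact: IS|exact: IS|by move/pval_inj|].
  by rewrite -pvalM; apply: has_order_pval.
move=> phi [phi_gen _]; exists phi => w.
have [u ru <-] := reduced_word parabolic_sq parabolic_gen w.
rewrite stdb_reduced // pval_wprod stdb_reduced; last exact: reduced_pval.
rewrite rmorph_prod big_map big_seq [RHS]big_seq; apply: eq_bigr => s /ru.1.
exact: phi_gen.
Qed.

Section CoordEmbedding.
Variables (H : lmodType laurent) (HI : lmodType laurent).
Variables (b : W -> H) (bI : parabolic I -> HI) (phi : {linear HI -> H}).
Hypotheses (hb : is_basis b) (hbI : is_basis bI).
Hypothesis phi_b : forall w, phi (bI w) = b (pval w).

(** The bases are left general because the lemma serves both for T and for c. *)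
Lemma coord_embed h w : coord b (phi h) (pval w) = coord bI h w.
Proof.
move: h; apply: (basis_ind hbI) => [|g h IH1 IH2|p h IH|x].
- by rewrite linear0 (coord0 hb) (coord0 hbI).
- by rewrite linearD (coordD hb) (coordD hbI) IH1 IH2.
- by rewrite linearZ (coordZ hb) (coordZ hbI) IH.
- by rewrite phi_b (coord_b hb) (coord_b hbI) (inj_eq pval_inj).
Qed.

Lemma coord_embed_out h (v : W) :
  coord b (phi h) v <> 0 -> exists w, v = pval w.
Proof.
move=> hv; apply: contrapT => no; apply: hv.
move: h; apply: (basis_ind hbI) => [|g h IH1 IH2|p h IH|x].
- by rewrite linear0 (coord0 hb).
- by rewrite linearD (coordD hb) IH1 IH2 addr0.
- by rewrite linearZ (coordZ hb) IH mulr0.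
- by rewrite phi_b (coord_b hb); case: eqP => // xv; case: no; exists x.
Qed.

End CoordEmbedding.

(** The image of c_w meets the characterization of c_w in the larger algebra: the embedding commutes
    with [bar], as seen on ring generators, and T-coordinates are kept on W_I and vanish
    elsewhere. *)
Lemma canb_embedding : exists phi : {lrmorphism hecke DI -> hecke D},
  forall w, phi (canb DI w) = canb D (pval w).
Proof.
have [phi phiT] := hecke_embedding; exists phi => w.
have bT : is_basis (stdb D) := @stdb_basis _ _ _ D.
have bTI : is_basis (stdb DI) := @stdb_basis _ _ _ DI.
have phiA p : phi p%:A = p%:A by rewrite linearZ rmorph1.
have phi_bar h : phi (bar DI h) = bar D (phi h).
  move: h; apply: (hecke_ind parabolic_sq parabolic_gen).
  - by move=> g h IH1 IH2; rewrite !rmorphD /= IH1 IH2.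
  - by move=> h IH; rewrite !rmorphN /= IH.
  - by move=> g h IH1 IH2; rewrite !rmorphM /= IH1 IH2.
  - by rewrite !rmorph1.
  - by rewrite phiA !bar_vpow_gen phiA.
  - by rewrite phiA !bar_vpow_gen phiA.
  - by move=> s Is; rewrite phiT !bar_gen // ?rmorphB /= ?phiA ?phiT //; apply: IS.
apply/esym/canonical_uniq; have [h1 h2 h3] := canonicalP DI w; split.
- by rewrite -phi_bar h1.
- by rewrite (coord_embed bT bTI phiT).
- move=> v vw; have [->|/eqP] := eqVneq (coord (stdb D) (phi (canb DI w)) v) 0.
    exact: in_vZ0.
  move/(coord_embed_out bT bTI phiT) => [x vx].
  by rewrite vx (coord_embed bT bTI phiT); apply: h3 => xw; apply: vw; rewrite vx xw.
Qed.

Lemma hcoef_pval x y z : hcoef D (pval x) (pval y) (pval z) = hcoef DI x y z.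
Proof.
have [phi phiC] := canb_embedding; rewrite /hcoef -!phiC -rmorphM.
exact: (coord_embed (@canb_basis _ _ _ D) (@canb_basis _ _ _ DI) phiC).
Qed.

Lemma hcoef_pval_out x y (v : W) :
  hcoef D (pval x) (pval y) v <> 0 -> exists w, v = pval w.
Proof.
have [phi phiC] := canb_embedding; rewrite /hcoef -!phiC -rmorphM.
exact: (coord_embed_out (@canb_basis _ _ _ D) (@canb_basis _ _ _ DI) phiC).
Qed.

Lemma afun_pval y : bounded D -> P3 D -> P7 D -> afun DI y = afun D (pval y).
Proof.
move=> D_bounded hP3 hP7.
(* The value of a in W bounds the structure constants of W_I, so the minimum defining a in W_I is
   attained. *)
have [hy aI_min] : (forall x z, in_vZ (afun DI y)%:Z (hcoef DI x z y)) /\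
    forall n : nat, (forall x z, in_vZ n%:Z (hcoef DI x z y)) -> (afun DI y <= n)%N.
  apply: (@least_spec (fun n : nat => forall x z, in_vZ n%:Z (hcoef DI x z y))).
  by exists (afun D (pval y)) => x z; rewrite -hcoef_pval; apply: hcoef_in_vZ.
apply/eqP; rewrite eqn_leq aI_min /=; last first.
  by move=> x z; rewrite -hcoef_pval; apply: hcoef_in_vZ.
have [d [[_ yd] _]] := hP3 (pval y).
(* Here d lies in W_I because c_(y^-1) c_y comes from the Hecke algebra of W_I. *)
have [e de] : exists e : parabolic I, d = pval e.
  have := gamma_hcoef yd; rewrite -pvalV => /hcoef_pval_out[e de].
  by exists e^-1%g; rewrite pvalV -de invgK.
(* A smaller value of a in W_I would make this coefficient vanish. *)
move: yd; rewrite hP7 /gamma invgK de hcoef_pval => nz.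
by rewrite leqNgt; apply/negP => lt; apply: nz; apply: hy.
Qed.

End Parabolic.

Theorem mainTheorem1 (W : groupType) (S : set W) (L : W -> int)
    (S_finite : finite_set S) (W_coxeter : coxeter_system S)
    (L_weight : weight_function S L) (L_pos : forall s, S s -> 0 < L s)
    (D : hecke_datum S L) (D_bounded : bounded D)
    (hP1 : P1 D) (hP2 : P2 D) (hP3 : P3 D) (hPtilde : Ptilde D) :
  [/\ P4 D, P5 D, P6 D & P7 D] /\
  [/\ P8 D, P9 D, P10 D & P11 D] /\
  [/\ P12 D, P13 D & P14 D].
Proof.
have hP7 : P7 D by apply: P7_holds.
split; [split | split; split] => //.
- exact: P4_holds.
- exact: P5_holds.
- exact: P6_holds.
- exact: P8_holds.
- exact: P9_holds.
- exact: P10_holds.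
- exact: P11_holds.
- by move=> I IS DI y; apply: afun_pval.
- exact: P13_holds.
- exact: P14_holds.
Qed.
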